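(* Let $B^1,\dots,B^r$ be processes on $[0,T]$ such that each $B^j$ is either a fractional Brownian motion with Hurst parameter $H_j>1/2$ or the identity function $B^j_t=t$, any two of them being either equal or independent (the distinct ones being mutually independent). Let $0=t_0<t_1<\cdots<t_n=T$ be a partition of $[0,T]$ and let $$\mathcal A=\bigcup_{k=0}^{n-1}[t_k,t_{k+1}]^r_<,\qquad\mathcal A'=\bigcup_{k=0}^{n-1}[t_k,t_{k+1}]^r.$$ Then $J_r(\mathcal A)$ and $J_r(\mathcal A')$ are well defined as iterated Riemann–Stieltjes integrals, and $$\mathbb E\big(|J_r(\mathcal A)|^2\big)\le\mathbb E\big(|J_r(\mathcal A')|^2\big).$$
   Context: $[s,t]^r_<=\{(s_1,\dots,s_r)\in[0,T]^r:s\le s_1\le\cdots\le s_r\le t\}$. For a Borel set $\mathcal A\subset[0,T]^r$, $J_r(\mathcal A)=\int_0^T\cdots\int_0^T\mathbf 1_{\mathcal A}(s_1,\dots,s_r)\,dB^1_{s_1}\cdots dB^r_{s_r}$, whenever this exists as an iterated Riemann–Stieltjes integral defined by $L_p$-convergence of Riemann sums $\sum_kf_{u_k}(g_{u_{k+1}}-g_{u_k})$ for $L_p$-valued functions ($u_k=kT/l$, $l\to\infty$). A fractional Brownian motion of Hurst parameter $H\in(0,1)$ is a centered Gaussian process with covariance $\frac12(t^{2H}+s^{2H}-|t-s|^{2H})$. *)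

(* Defs.v *)
From HB Require Import structures.
From mathcomp Require Import all_boot all_order all_algebra.
From mathcomp Require Import all_classical all_reals all_analysis.

Set Implicit Arguments.
Unset Strict Implicit.
Unset Printing Implicit Defensive.

Import Order.TTheory GRing.Theory Num.Theory.
Import numFieldNormedType.Exports.

Local Open Scope classical_set_scope.
Local Open Scope ring_scope.

(* A real process on [0, T] is a map [R -> Omega -> R]; its values at times
   outside [0, T] are never used. *)

(* [normal_prob m sigma] is N(m, sigma^2) for [sigma != 0] only, so constants
   (the degenerate Gaussian laws) are listed separately. *)
Definition gaussian_rv d (Omega : measurableType d) (R : realType)
    (P : probability Omega R) (X : Omega -> R) : Prop :=
  measurable_fun setT X /\
  ((exists m : R, {ae P, forall w, X w = m}) \/
   (exists m sigma : R, 0 < sigma /\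
      forall U : set R, measurable U -> P (X @^-1` U) = normal_prob m sigma U)).

(* The finite-dimensional distributions are multivariate normal: every linear
   combination of the coordinates is normal. *)
Definition gaussian_process d (Omega : measurableType d) (R : realType)
    (P : probability Omega R) (T : R) (X : R -> Omega -> R) : Prop :=
  forall (n : nat) (t c : 'I_n -> R), (forall i, t i \in `[0, T]) ->
    gaussian_rv P (fun w => \sum_(i < n) c i * X (t i) w).

Definition is_fBm d (Omega : measurableType d) (R : realType)
    (P : probability Omega R) (T H : R) (X : R -> Omega -> R) : Prop :=
  [/\ 0 < H < 1,
      gaussian_process P T X,
      forall t : R, t \in `[0, T] -> ('E_P[X t] = 0)%E &
      forall s t : R, s \in `[0, T] -> t \in `[0, T] ->
        covariance P (X s) (X t) =
          (2^-1 * (t `^ (2 * H) + s `^ (2 * H) - `|t - s| `^ (2 * H)))%:E].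

Definition is_time d (Omega : measurableType d) (R : realType)
    (T : R) (X : R -> Omega -> R) : Prop :=
  forall t : R, t \in `[0, T] -> forall w, X t w = t.

Definition same_process d (Omega : measurableType d) (R : realType)
    (T : R) (X Y : R -> Omega -> R) : Prop :=
  forall t : R, t \in `[0, T] -> X t = Y t.

Definition process_sigma_algebra d (Omega : measurableType d) (R : realType)
    (T : R) (X : R -> Omega -> R) : set (set Omega) :=
  <<s [set E | exists (t : R) (U : set R),
         [/\ t \in `[0, T], measurable U & E = X t @^-1` U] ] >>.

(* The whole space lies in each sigma-algebra, so the product rule over all of
   [D] contains the product rule over every subfamily. *)
Definition mutually_independent d (Omega : measurableType d) (R : realType)
    (P : probability Omega R) (T : R) (I : finType) (D : {set I})
    (X : I -> R -> Omega -> R) : Prop :=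
  forall E : I -> set Omega,
    (forall i, i \in D -> process_sigma_algebra T (X i) (E i)) ->
    fine (P (\bigcap_(i in [set` D]) E i)) = \prod_(i in D) fine (P (E i)).

(* Any two members of the family are equal or independent, the distinct ones
   being mutually independent. *)
Definition equal_or_independent d (Omega : measurableType d) (R : realType)
    (P : probability Omega R) (T : R) (I : finType)
    (X : I -> R -> Omega -> R) : Prop :=
  forall D : {set I},
    (forall i j, i \in D -> j \in D -> i != j ->
       ~ same_process T (X i) (X j)) ->
    mutually_independent P T D X.

Definition riemann_sum (Omega : Type) (R : realType) (T : R)
    (f g : R -> Omega -> R) (l : nat) : Omega -> R :=
  let u k := k%:R * T / l%:R in
  fun w => \sum_(k < l) f (u k) w * (g (u k.+1) w - g (u k) w).

(* [X] is a version of the Riemann-Stieltjes integral of [f] against [g] over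
   [0, T], both seen as functions with values in L_p. *)
Definition is_RS_integral d (Omega : measurableType d) (R : realType)
    (P : probability Omega R) (p T : R) (f g : R -> Omega -> R)
    (X : Omega -> R) : Prop :=
  [/\ forall u : R, u \in `[0, T] -> f u \in Lfun P p%:E,
      forall u : R, u \in `[0, T] -> g u \in Lfun P p%:E,
      X \in Lfun P p%:E &
      ('N[P]_p%:E[EFin \o (riemann_sum T f g l \- X)%R])%E @[l --> \oo] --> 0%E].

Definition cube (R : realType) (r : nat) (a b : R) : set (r.-tuple R) :=
  [set s | forall i, tnth s i \in `[a, b]].

(* The simplex of all (s_1, ..., s_r) in [0, T]^r with
   a <= s_1 <= ... <= s_r <= b. *)
Definition simplex (R : realType) (r : nat) (T a b : R) : set (r.-tuple R) :=
  cube 0 T `&` [set s : r.-tuple R | path <=%R a (rcons s b)].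

(* [is_iterated_integral P p T B phi J]: the iterated integral
   int_0^T ... int_0^T phi(s_1, ..., s_r) dB^1_{s_1} ... dB^r_{s_r} exists and
   [J] is a version of it.  The integral in s_1 is the innermost one, and
   [psi] is its value as a function of the remaining variables. *)
Fixpoint is_iterated_integral d (Omega : measurableType d) (R : realType)
    (P : probability Omega R) (p T : R) (r : nat) :
    ('I_r -> R -> Omega -> R) -> (r.-tuple R -> Omega -> R) ->
    (Omega -> R) -> Prop :=
  match r with
  | 0 => fun _ phi J => J = phi [tuple]
  | q.+1 => fun B phi J => exists psi : q.-tuple R -> Omega -> R,
      (forall s : q.-tuple R, cube 0 T s ->
         is_RS_integral P p T (fun u => phi [tuple of u :: s]) (B ord0)
           (psi s)) /\
      is_iterated_integral P p T (fun i => B (lift ord0 i)) psi J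
  end.

(* [J] is a version of J_r(A). *)
Definition is_J d (Omega : measurableType d) (R : realType)
    (P : probability Omega R) (p T : R) (r : nat) (B : 'I_r -> R -> Omega -> R)
    (A : set (r.-tuple R)) (J : Omega -> R) : Prop :=
  is_iterated_integral P p T B (fun s _ => \1_A s) J.

Definition J_well_defined d (Omega : measurableType d) (R : realType)
    (P : probability Omega R) (p T : R) (r : nat) (B : 'I_r -> R -> Omega -> R)
    (A : set (r.-tuple R)) : Prop :=
  (exists J, is_J P p T B A J) /\
  (forall J1 J2, is_J P p T B A J1 -> is_J P p T B A J2 ->
     {ae P, forall w, J1 w = J2 w}).

(* Main.v *)
Require Import Defs.
From HB Require Import structures.
From mathcomp Require Import all_boot all_order all_algebra.
From mathcomp Require Import all_classical all_reals all_analysis.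
From mathcomp Require Import measurable_realfun.
From mathcomp Require Import ring lra.

Set Implicit Arguments.
Unset Strict Implicit.
Unset Printing Implicit Defensive.

Import Order.TTheory GRing.Theory Num.Theory.
Import numFieldNormedType.Exports.

Local Open Scope classical_set_scope.
Local Open Scope ring_scope.

(** Positivity is what makes the inequality true.  For [u <= v] the increments
[B j v - B j u] of a fractional Brownian motion with Hurst parameter above 1/2
are nonnegatively correlated, because [x |-> |x|^(2H)] is convex.  By
Isserlis' formula the expectation of a product of centered jointly Gaussian
variables is a sum of products of covariances, hence nonnegative here
([gauss_product_ge0]); independence extends this to products that mix several
processes and time ([increment_product_ge0]).  Since the indicator of [A] is
below the indicator of [A'], both [J' - J] and [J' + J] are iterated limits of
nonnegative combinations of products of increments, so that
[E (J'^2) - E (J^2) = E ((J' - J) * (J' + J)) >= 0].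

The limits are taken one variable at a time, and separately in the two
factors.  Cones take care of this.  Let [dual_cone K] be the set of all [X]
such that [E (X * Z) >= 0] for every [Z] in [K].  It is closed under sums and
limits, and it is stable under multiplication by increments when [K] is;
hence it contains the iterated integrals of the integrands that it contains
([dual_cone_integral]).  This applies to the set of products of increments,
which puts [J' + J] into its dual cone, and then to that dual cone, which puts
[J' - J] into the bidual cone ([integral_mono]).

Existence is Young's theory of integration with values in Lq.  The increments
of the processes have Lq norms of order [|t - s|^a] for a common exponent
[a > 1/2], so the Riemann sums on a uniform grid and on a refinement of it
differ by [O(l^(1 - 2 * a))] ([young_refine]) and form a Cauchy sequence.
Hölder's inequality halves the exponent of integrability in a product, and an
iterated integral needs several products; therefore all limits are taken in
every Lq at once ([Lall], [cvg_Lall]).  On a cube the integrand of each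
successive integral is constant in time.  On a simplex the inner integral, as
a function of its upper end point, is again Hölder with exponent [a]
([primitive_exists]), so that the next integral is of the same type.  The
indicator of a union of consecutive pieces is handled by linearity, since two
neighbours meet in a degenerate piece only ([union_integral]). *)

(** * Random variables with moments of all orders *)

Section Lq_bounds.
Context d (Omega : measurableType d) (R : realType) (P : probability Omega R).
Implicit Types (X Y Z : Omega -> R) (q C D : R).

(** Norms are bounded by real numbers, so that the estimates are computed in [R]
and not in the extended reals. *)
Definition Lnorm_le q X C :=
  measurable_fun setT X /\ ('N[P]_q%:E[EFin \o X] <= C%:E)%E.

Lemma Lnorm_le_ge0 q X C : Lnorm_le q X C -> 0 <= C.
Proof. by case=> _ /(le_trans (Lnorm_ge0 _ _ _)); rewrite lee_fin. Qed.

Lemma Lnorm_le_eq q X Y C : X =1 Y -> Lnorm_le q X C -> Lnorm_le q Y C.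
Proof. by move=> /funext ->. Qed.

Lemma Lnorm_le_weak q X C D : C <= D -> Lnorm_le q X C -> Lnorm_le q X D.
Proof. by move=> CD [mX XC]; split=> //; apply: le_trans XC _; rewrite lee_fin. Qed.

Lemma Lnorm_leD q X Y C D : 1 <= q -> Lnorm_le q X C -> Lnorm_le q Y D ->
  Lnorm_le q (fun w => X w + Y w) (C + D).
Proof.
move=> q1 [mX XC] [mY YD]; split; first exact: measurable_funD.
apply: (le_trans (minkowski_EFin P mX mY q1)).
by rewrite EFinD; apply: leeD.
Qed.

Lemma Lnorm_leN q X C : Lnorm_le q X C -> Lnorm_le q (fun w => - X w) C.
Proof.
move=> [mX XC]; split; first exact: measurableT_comp.
by rewrite -(oppe_Lnorm P (EFin \o X)) in XC.
Qed.

Lemma Lnorm_leB q X Y C D : 1 <= q -> Lnorm_le q X C -> Lnorm_le q Y D ->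
  Lnorm_le q (fun w => X w - Y w) (C + D).
Proof. by move=> q1 hX hY; apply: Lnorm_leD => //; apply: Lnorm_leN. Qed.

Lemma Lnorm_le_cst q c : 0 < q -> Lnorm_le q (cst c) `|c|.
Proof.
move=> q0; split; first exact: measurable_cst.
rewrite unlock /Lnorm.
rewrite (eq_integral (cst (`|c| `^ q)%:E))//.
rewrite integral_cst//= probability_setT mule1 poweR_EFin -powRrM mulfV ?gt_eqF//.
by rewrite powRr1.
Qed.

Lemma Lnorm_powq q X : 0 < q -> ('N[P]_q%:E[EFin \o X] `^ q =
  \int[P]_w (`|X w| `^ q)%:E)%E.
Proof. by move=> q0; rewrite poweR_Lnorm ?gt_eqF//; apply: eq_integral. Qed.

Lemma measurable_abspow q X : measurable_fun setT X ->
  measurable_fun setT (fun w => `|X w| `^ q).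
Proof.
move=> mX.
apply: (@measurableT_comp _ _ _ _ _ _ (fun x : R => x `^ q)%R) => //.
exact: measurableT_comp.
Qed.

Lemma Lnorm_leP q X C : 0 < q -> 0 <= C -> measurable_fun setT X ->
  Lnorm_le q X C <-> (\int[P]_w (`|X w| `^ q)%:E <= (C `^ q)%:E)%E.
Proof.
move=> q0 C0 mX; rewrite -Lnorm_powq//; split.
  move=> [_ XC]; rewrite -poweR_EFin; apply: gt0_ler_poweR => //.
  - exact: ltW.
  - by rewrite in_itv/= Lnorm_ge0 leey.
  - by rewrite in_itv/= lee_fin C0 leey.
move=> h; split => //.
have qV0 : 0 <= q^-1 by rewrite invr_ge0 ltW.
have : ('N[P]_q%:E[EFin \o X] `^ q `^ q^-1 <= (C `^ q)%:E `^ q^-1)%E.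
  apply: gt0_ler_poweR => //.
    by rewrite in_itv/= poweR_ge0 leey.
  by rewrite in_itv/= lee_fin powR_ge0 leey.
rewrite -poweRrM mulfV ?gt_eqF// poweRe1 ?Lnorm_ge0// poweR_EFin -powRrM mulfV ?gt_eqF//.
by rewrite powRr1.
Qed.

(** Hoelder's inequality with both exponents equal to 2, for [|X|^q] and [|Y|^q]. *)
Lemma Lnorm_leM q X Y C D : 0 < q -> Lnorm_le (2 * q) X C -> Lnorm_le (2 * q) Y D ->
  Lnorm_le q (fun w => X w * Y w) (C * D).
Proof.
move=> q0 bX bY.
have q20 : 0 < 2 * q by rewrite mulr_gt0.
have C0 := Lnorm_le_ge0 bX; have D0 := Lnorm_le_ge0 bY.
have mX := bX.1; have mY := bY.1.
apply/Lnorm_leP => //; [exact: mulr_ge0|exact: measurable_funM|].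
move: bX bY => /Lnorm_leP-/(_ q20 C0 mX) bX /Lnorm_leP-/(_ q20 D0 mY) bY.
have := @hoelder _ _ _ P _ _ 2 2 (measurable_abspow q mX) (measurable_abspow q mY).
rewrite !ltr0n [_ + _ = _]/= => /(_ isT isT).
have -> : (2^-1 + 2^-1 = 1 :> R) by rewrite [RHS]splitr !div1r.
move=> /(_ erefl); rewrite Lnorm1.
under eq_integral do rewrite /= ger0_norm ?mulr_ge0 ?powR_ge0// -powRM// -normrM.
move=> /le_trans; apply.
have N2 Z E : 0 <= E -> (\int[P]_w (`|Z w| `^ (2 * q))%:E <= (E `^ (2 * q))%:E)%E ->
   ('N[P]_2%:E[EFin \o (fun w => (`|Z w| `^ q)%R)] <= (E `^ q)%:E)%E.
  move=> E0 hZ; rewrite unlock /Lnorm.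
  under eq_integral do rewrite /= ger0_norm ?powR_ge0// -powRrM mulrC.
  have V0 : 0 <= 2^-1 :> R by rewrite invr_ge0 ler0n.
  have : ((\int[P]_w (`|Z w| `^ (2 * q))%:E) `^ 2^-1 <= (E `^ (2 * q))%:E `^ 2^-1)%E.
    apply: gt0_ler_poweR => //.
      by rewrite in_itv/= leey integral_ge0// => w _; rewrite lee_fin powR_ge0.
    by rewrite in_itv/= leey lee_fin powR_ge0.
  by rewrite poweR_EFin -powRrM mulrAC mulfV ?mul1r.
rewrite powRM// EFinM; apply: lee_pmul; rewrite ?Lnorm_ge0//.
  exact: N2.
exact: N2.
Qed.

Lemma Lnorm_leZ q c X C : 1 <= q -> Lnorm_le q X C -> Lnorm_le q (fun w => c * X w) (`|c| * C).
Proof.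
move=> q1 bX; have q0 : 0 < q by apply: lt_le_trans q1.
have C0 := Lnorm_le_ge0 bX; have mX := bX.1.
apply/Lnorm_leP => //; [exact: mulr_ge0|by apply: measurable_funM|].
move: bX => /Lnorm_leP-/(_ q0 C0 mX) bX.
under eq_integral do rewrite normrM powRM// EFinM.
rewrite ge0_integralZl//=; first last.
- by apply/measurable_EFinP/measurable_abspow.
by rewrite powRM// EFinM; apply: lee_pmul => //; rewrite ?lee_fin ?powR_ge0//
  integral_ge0// => w _; rewrite lee_fin powR_ge0.
Qed.

Lemma Lnorm_le0 q C : 0 < q -> 0 <= C -> Lnorm_le q (fun=> 0) C.
Proof. by move=> q0 C0; apply: Lnorm_le_weak (Lnorm_le_cst _ q0); rewrite normr0. Qed.

Lemma Lnorm_le_sum q (I : Type) (s : seq I) (X : I -> Omega -> R) (C : I -> R) :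
  1 <= q -> (forall i, Lnorm_le q (X i) (C i)) ->
  Lnorm_le q (fun w => \sum_(i <- s) X i w) (\sum_(i <- s) C i).
Proof.
move=> q1 bX; elim: s => [|i s IH].
  rewrite big_nil; apply: Lnorm_le_eq (Lnorm_le0 (lt_le_trans ltr01 q1) (lexx 0)).
  by move=> w; rewrite big_nil.
rewrite big_cons; apply: Lnorm_le_eq (Lnorm_leD q1 (bX i) IH).
by move=> w; rewrite big_cons.
Qed.

Lemma Lnorm_le_ae q X Y C : measurable_fun setT Y -> {ae P, forall w, X w = Y w} ->
  Lnorm_le q X C -> Lnorm_le q Y C.
Proof.
move=> mY XY [mX bX]; split => //; move: bX; rewrite unlock /Lnorm.
rewrite (@ae_eq_integral _ _ _ _ _ (fun w => `|(EFin \o X) w| `^ q)%E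
   (fun w => `|(EFin \o Y) w| `^ q)%E measurableT)//.
- apply: (@measurableT_comp _ _ _ _ _ _ (fun x : \bar R => x `^ q)%E).
    exact: measurable_poweR.
  by apply: measurableT_comp => //; apply/measurable_EFinP.
- apply: (@measurableT_comp _ _ _ _ _ _ (fun x : \bar R => x `^ q)%E).
    exact: measurable_poweR.
  by apply: measurableT_comp => //; apply/measurable_EFinP.
- by apply: filterS XY => w /= ->.
Qed.

Lemma Lnorm_le0_ae q X : 0 < q -> (forall e, 0 < e -> Lnorm_le q X e) ->
  {ae P, forall w, X w = 0}.
Proof.
move=> q0 h; have [mX _] := h 1 ltr01.
have : ('N[P]_q%:E[EFin \o X] = 0)%E.
  apply/eqP; rewrite eq_le Lnorm_ge0 andbT; apply/lee_addgt0Pr => e e0.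
  by rewrite add0e; case: (h e e0).
have mEX : measurable_fun [set: Omega] (EFin \o X) by apply/measurable_EFinP.
have q0' : (0 < q%:E)%E by rewrite lte_fin.
by move/(Lnorm_eq0_eq0 mEX q0'); apply: filterS => w /= /(_ I) [].
Qed.

(** The space often written L^(oo-), the intersection of all Lq: in contrast to a
single Lq it is stable under products. *)
Definition Lall X := forall q, 1 <= q -> exists C, Lnorm_le q X C.

Definition cvg_Lall (S : nat -> Omega -> R) X := forall q e, 1 <= q -> 0 < e ->
  exists N, forall n, (N <= n)%N -> Lnorm_le q (fun w => S n w - X w) e.

Lemma Lall_meas X : Lall X -> measurable_fun setT X.
Proof. by move=> /(_ 1 (lexx _))[C []]. Qed.

Lemma LallD X Y : Lall X -> Lall Y -> Lall (fun w => X w + Y w).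
Proof.
move=> hX hY q q1; have [C hC] := hX q q1; have [D hD] := hY q q1.
by exists (C + D); apply: Lnorm_leD.
Qed.

Lemma LallB X Y : Lall X -> Lall Y -> Lall (fun w => X w - Y w).
Proof.
move=> hX hY q q1; have [C hC] := hX q q1; have [D hD] := hY q q1.
by exists (C + D); apply: Lnorm_leB.
Qed.

Lemma LallM X Y : Lall X -> Lall Y -> Lall (fun w => X w * Y w).
Proof.
move=> hX hY q q1; have q2 : 1 <= 2 * q by lra.
have [C hC] := hX _ q2; have [D hD] := hY _ q2.
by exists (C * D); apply: Lnorm_leM => //; lra.
Qed.

Lemma Lall_cst c : Lall (fun=> c).
Proof. by move=> q q1; exists `|c|; apply: Lnorm_le_cst; lra. Qed.

Lemma Lall_sum (I : Type) (s : seq I) (X : I -> Omega -> R) :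
  (forall i, Lall (X i)) -> Lall (fun w => \sum_(i <- s) X i w).
Proof.
move=> hX; elim: s => [|i s IH].
  rewrite (_ : (fun w => _) = (fun=> 0)); first exact: Lall_cst.
  by apply/funext => w; rewrite big_nil.
rewrite (_ : (fun w => _) = (fun w => X i w + \sum_(i <- s) X i w)); first exact: LallD.
by apply/funext => w; rewrite big_cons.
Qed.

Lemma Lall_prod (I : Type) (s : seq I) (X : I -> Omega -> R) :
  (forall i, Lall (X i)) -> Lall (fun w => \prod_(i <- s) X i w).
Proof.
move=> hX; elim: s => [|i s IH].
  rewrite (_ : (fun w => _) = (fun=> 1)); first exact: Lall_cst.
  by apply/funext => w; rewrite big_nil.
rewrite (_ : (fun w => _) = (fun w => X i w * \prod_(i <- s) X i w)); first exact: LallM.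
by apply/funext => w; rewrite big_cons.
Qed.

(** [S] is meant to be a sequence of Riemann sums; with no cell at all such a sum
does not approximate the integral, so the bound starts at the index 1. *)
Lemma Lnorm_le_lim q S X C : 1 <= q ->
  (forall n, (0 < n)%N -> Lnorm_le q (S n) C) -> cvg_Lall S X -> Lnorm_le q X C.
Proof.
move=> q1 hS SX; have [N hN] := SX q 1 q1 ltr01.
have mX : measurable_fun setT X.
  have -> : X = (fun w => S N.+1 w - (S N.+1 w - X w)).
    by apply/funext => w; rewrite subKr.
  apply: measurable_funB; first by case: (hS N.+1 isT).
  by case: (hN N.+1 (leqnSn _)).
split=> //; apply/lee_addgt0Pr => e e0; rewrite -EFinD.
have [M hM] := SX q e q1 e0.
have : Lnorm_le q X (C + e).
  apply: Lnorm_le_eq (Lnorm_leB q1 (hS M.+1 isT) (hM M.+1 (leqnSn _))).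
  by move=> w; rewrite subKr.
by case.
Qed.

Lemma Lall_Lfun X q : 1 <= q -> Lall X -> X \in Lfun P q%:E.
Proof.
move=> q1 /(_ q q1)[C [mX XC]]; rewrite inE; apply/andP; split; rewrite inE//.
by rewrite /finite_norm; apply: le_lt_trans XC _; rewrite ltry.
Qed.

Definition Ex X : R := fine 'E_P[X].

Lemma Ex_le_Lnorm X C : Lnorm_le 1 X C -> `|Ex X| <= C.
Proof.
move=> [mX]; rewrite Lnorm1 => hX.
have hi : (`|'E_P[X]| <= C%:E)%E.
  rewrite unlock; apply: le_trans hX.
  by apply: le_abse_integral => //; apply/measurable_EFinP.
rewrite -lee_fin; apply: le_trans hi; rewrite /Ex.
by case: ('E_P[X])%E => [r||]//=; rewrite ?leey ?lee_fin ?normr0.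
Qed.

Lemma Lall_fin X : Lall X -> 'E_P[X]%E = (Ex X)%:E.
Proof.
move=> hX; rewrite fineK// expectation_fin_num//; exact: Lall_Lfun.
Qed.

Lemma ExD X Y : Lall X -> Lall Y -> Ex (fun w => X w + Y w) = Ex X + Ex Y.
Proof.
move=> hX hY; have h Z := @Lall_Lfun Z 1 (lexx 1).
by rewrite /Ex expectationD ?h// fineD// expectation_fin_num ?h.
Qed.

Lemma ExB X Y : Lall X -> Lall Y -> Ex (fun w => X w - Y w) = Ex X - Ex Y.
Proof.
move=> hX hY; have h Z := @Lall_Lfun Z 1 (lexx 1).
by rewrite /Ex expectationB ?h// fineB// expectation_fin_num ?h.
Qed.

Lemma Ex_cst c : Ex (fun=> c) = c.
Proof. by rewrite /Ex expectation_cst. Qed.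

Lemma ExZ c X : Lall X -> Ex (fun w => c * X w) = c * Ex X.
Proof.
move=> hX; have h Z := @Lall_Lfun Z 1 (lexx 1).
rewrite /Ex (_ : (fun w => _) = (c \o* X)); last first.
  by apply/funext => w /=; rewrite mulrC.
by rewrite expectationZl ?h// fineM// expectation_fin_num ?h.
Qed.

Lemma Ex_sum (I : Type) (s : seq I) (X : I -> Omega -> R) : (forall i, Lall (X i)) ->
  Ex (fun w => \sum_(i <- s) X i w) = \sum_(i <- s) Ex (X i).
Proof.
move=> hX; elim: s => [|i s IH].
  rewrite big_nil (_ : (fun w => _) = (fun=> 0)) ?Ex_cst//.
  by apply/funext => w; rewrite big_nil.
rewrite big_cons -IH -ExD//; last exact: Lall_sum.
by congr Ex; apply/funext => w; rewrite big_cons.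
Qed.

Lemma Ex_ae X Y : Lall X -> Lall Y -> {ae P, forall w, X w = Y w} -> Ex X = Ex Y.
Proof.
move=> hX hY XY; rewrite /Ex unlock; congr fine; apply: ae_eq_integral => //.
- by apply/measurable_EFinP; apply: Lall_meas.
- by apply/measurable_EFinP; apply: Lall_meas.
- by apply: filterS XY => w /= ->.
Qed.

(** The pairing with [Z] is continuous for the L2 norm. *)
Lemma cvg_Lall_ge0 S X Z : (forall n, Lall (S n)) -> Lall X -> Lall Z -> cvg_Lall S X ->
  (forall n, 0 <= Ex (fun w => S n w * Z w)) -> 0 <= Ex (fun w => X w * Z w).
Proof.
move=> hS hX hZ SX h.
have q2 : 1 <= 2 * 1 :> R by lra.
have [C hC] := hZ _ q2.
have C0 := Lnorm_le_ge0 hC.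
apply/ler_addgt0Pr => e e0.
have e1 : 0 < e / (C + 1) by rewrite divr_gt0// ltr_pwDr.
have [N hN] := SX _ _ q2 e1.
have := Ex_le_Lnorm (Lnorm_leM ltr01 (hN N (leqnn _)) hC).
have -> : (fun w => (S N w - X w) * Z w) = (fun w => S N w * Z w - X w * Z w).
  by apply/funext => w; rewrite mulrBl.
rewrite ExB; [|exact: LallM|exact: LallM].
move=> /ler_normlP[_]; rewrite lerBlDr => H.
apply: le_trans (h N) _; apply: le_trans H _; rewrite addrC lerD2l.
rewrite mulrAC ler_pdivrMr ?ltr_pwDr//.
by rewrite ler_pM2l// lerDl.
Qed.

Lemma limn_einf_le (u : nat -> \bar R) c : (forall n, u n <= c)%E -> (limn_einf u <= c)%E.
Proof.
move=> uc; rewrite limn_einf_lim; apply: lime_le; first exact: is_cvg_einfs.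
apply: nearW => n; apply: le_trans (uc n).
by apply: ereal_inf_lbound => /=; exists n => /=.
Qed.

Lemma cvg_of_summable_increments (f : nat -> R) :
  (\sum_(k <oo) (`|f k.+1 - f k|)%:E < +oo)%E -> cvgn f.
Proof.
move=> h; have := @nnseries_is_cvg R (fun k => `|f k.+1 - f k|) (fun=> normr_ge0 _) h.
move=> /(@normed_cvg _ R (fun k => f k.+1 - f k)) /cvg_ex[l hl].
apply/cvg_ex; exists (f 0%N + l).
have := cvgD (cvg_cst (f 0%N)) hl.
have -> : (fun=> f 0%N) + series (fun k => f k.+1 - f k) = f.
  by apply/funext => n; rewrite !fctE /series/= telescope_sumr// subrKC.
exact.
Qed.

(** The total variation of the sequence has expectation at most 2, so it is
finite almost everywhere. *)
Lemma ae_cvg_of_fast f : (forall k, Lnorm_le 1 (fun w => f k.+1 w - f k w) (2^-1 ^+ k)) ->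
  {ae P, forall w, cvgn (f ^~ w)}.
Proof.
move=> bf; pose D k w := `|f k.+1 w - f k w|.
have mD k : measurable_fun setT (fun w => (D k w)%:E).
  by apply/measurable_EFinP; apply: measurableT_comp => //; case: (bf k).
have iD k : (\int[P]_w (D k w)%:E <= (2^-1 ^+ k)%:E)%E.
  by have [_] := bf k; rewrite Lnorm1.
have I2 : (\int[P]_w \sum_(k <oo) (D k w)%:E <= 2%:E)%E.
  rewrite integral_nneseries//; last by move=> k w _; rewrite lee_fin normr_ge0.
  apply: lime_le.
    by apply: is_cvg_nneseries => k _ _; apply: integral_ge0 => w _; rewrite lee_fin normr_ge0.
  apply: nearW => n.
  apply: (@le_trans _ _ (\sum_(0 <= k < n) (2^-1 ^+ k)%:E)%E); first by apply: lee_sum.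
  rewrite sumEFin lee_fin.
  have := @geometric_le_lim R n 1 2^-1 ler01.
  rewrite invr_gt0 ltr0n => /(_ isT); rewrite ger0_norm ?invr_ge0//.
  rewrite invf_lt1 ?ltr1n// => /(_ isT).
  have -> : 1 - 2^-1 = 2^-1 :> R by lra.
  rewrite div1r invrK.
  by apply: le_trans; rewrite /series/=; apply: ler_sum => k _; rewrite /geometric/= mul1r.
have G0 w : (0 <= \sum_(k <oo) (D k w)%:E)%E.
  by apply: nneseries_ge0 => k _ _; rewrite lee_fin normr_ge0.
have : P.-integrable setT (fun w => \sum_(k <oo) (D k w)%:E)%E.
  apply/integrableP; split.
    by apply: ge0_emeasurable_sum => // k w _ _; rewrite lee_fin normr_ge0.
  under eq_integral do rewrite gee0_abs//.
  by apply: le_lt_trans I2 _; rewrite ltry.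
move/(integrable_ae measurableT); apply: filterS => w /= /(_ I).
rewrite ge0_fin_numE// => h; exact: cvg_of_summable_increments.
Qed.

Lemma continuous_normpow q : 0 < q -> continuous (fun x : R => `|x| `^ q).
Proof.
move=> q0 x; have [->|x0] := eqVneq x 0.
  apply/cvgrPdist_le => e e0; rewrite normr0 powR0 ?gt_eqF//.
  have d0 : 0 < e `^ q^-1 by apply: powR_gt0.
  apply: filterS (nbhs0_lt (V := R) d0) => y /ltW ye.
  rewrite sub0r normrN ger0_norm ?powR_ge0//.
  have -> : e = (e `^ q^-1) `^ q by rewrite -powRrM mulVf ?gt_eqF// powRr1// ltW.
  by apply: ge0_ler_powR => //; rewrite ?nnegrE ?powR_ge0// ltW.
apply: (@continuous_comp _ _ _ (fun x : R => `|x|) (fun y => y `^ q)).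
  exact: norm_continuous.
have nx : 0 < `|x| by rewrite normr_gt0.
apply: differentiable_continuous; apply/derivable1_diffP.
by case: (is_derive1_powR q nx).
Qed.

(** A subsequence with L1 increments at most [2^-k] converges almost everywhere.
Fatou's lemma along it turns the Cauchy condition in Lq into convergence of
the whole sequence in Lq; the limit is the same for all [q]. *)
Lemma Lall_complete S : (forall n, Lall (S n)) ->
  (forall q e, 1 <= q -> 0 < e -> exists N, forall m n, (N <= m)%N -> (N <= n)%N ->
     Lnorm_le q (fun w => S m w - S n w) e) ->
  exists X, Lall X /\ cvg_Lall S X.
Proof.
move=> LS Scauchy.
have e0 k : 0 < 2^-1 ^+ k :> R by rewrite exprn_gt0// invr_gt0.
have /choice[N hN] := fun k => Scauchy 1 (2^-1 ^+ k) (lexx 1) (e0 k).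
(* an increasing sequence of indices with [N k <= phi k] *)
pose phi k := (\sum_(i < k.+1) (N i).+1)%N.
pose f k := S (phi k).
have Nphi k : (N k <= phi k)%N by rewrite /phi big_ord_recr/= addnS ltnW// ltnS leq_addl.
have phiS k : (phi k <= phi k.+1)%N by rewrite /phi [leqRHS]big_ord_recr/= leq_addr.
have mf k : measurable_fun setT (f k) by exact: (Lall_meas (LS _)).
have aecvg : {ae P, forall w, cvgn (f ^~ w)}.
  apply: ae_cvg_of_fast => k; apply: hN => //.
  exact: leq_trans (Nphi k) (phiS k).
pose X w := fine (limn_esup (fun k => (f k w)%:E)).
have mX : measurable_fun setT X.
  apply: (@measurableT_comp _ _ _ _ _ _ (@fine R)) => //.
  by apply: measurable_fun_limn_esup => k; apply/measurable_EFinP.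
have XE w : cvgn (f ^~ w) -> f ^~ w @ \oo --> X w.
  move=> hw; have hl : (f k w)%:E @[k --> \oo] --> (limn (f ^~ w))%:E.
    by apply: cvg_EFin => //; apply: nearW.
  by rewrite /X (cvg_limn_einf_sup hl).2/=.
have key : cvg_Lall S X.
  move=> q e q1 e_gt0; have [M hM] := Scauchy q e q1 e_gt0.
  exists M => n Mn.
  have q0 : 0 < q by lra.
  have mSX : measurable_fun setT (fun w => S n w - X w).
    by apply: measurable_funB => //; apply: Lall_meas.
  apply/Lnorm_leP => //; first exact: ltW.
  have mg k : measurable_fun setT (fun w => (`|S n w - f k w| `^ q)%:E).
    apply/measurable_EFinP/measurable_abspow/measurable_funB => //.
    exact: Lall_meas.
  have -> : (\int[P]_w (`|S n w - X w| `^ q)%:E =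
      \int[P]_w limn_einf (fun k => (`|S n w - f (k + M)%N w| `^ q)%:E))%E.
    apply: ae_eq_integral => //.
    - by apply/measurable_EFinP/measurable_abspow.
    - rewrite (_ : (fun w => _) = (fun w => - limn_esup
         (fun k => - (`|S n w - f (k + M)%N w| `^ q)%:E))%E).
        apply: measurableT_comp => //; apply: measurable_fun_limn_esup => k.
        by apply: measurableT_comp => //; exact: mg.
      by apply/funext => w; rewrite /limn_einf; congr (- limn_esup _)%E.
    apply: filterS aecvg => w /XE hw _.
    have : (`|S n w - f (k + M)%N w| `^ q)%:E @[k --> \oo] --> (`|S n w - X w| `^ q)%:E.
      apply: cvg_EFin; first exact: nearW.
      have c : continuous (fun x : R => `|S n w - x| `^ q).
        move=> x; apply: (@continuous_comp _ _ _ (fun x : R => S n w - x) (fun y => `|y| `^ q)).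
          by apply: cvgB; [exact: cvg_cst|exact: cvg_id].
        exact: continuous_normpow.
      apply: (@cvg_comp _ _ _ (fun k => f (k + M)%N w) (fun x : R => `|S n w - x| `^ q) _ _ _ _ (c (X w))).
      by rewrite (cvg_shiftn M (f ^~ w)).
    by move=> /cvg_limn_einf_sup[-> _].
  apply: (le_trans (fatou P measurableT _ _)).
  - by move=> k; exact: mg.
  - by move=> k w _; rewrite lee_fin powR_ge0.
  apply: limn_einf_le => k.
  have mk : measurable_fun setT (fun w => S n w - f (k + M)%N w).
    by apply: measurable_funB => //; exact: Lall_meas.
  apply/(Lnorm_leP q0 (ltW e_gt0) mk).
  apply: hM => //.
  have phi_ge j : (j <= phi j)%N.
    by elim: j => // j IH; rewrite /phi big_ord_recr/= addnS ltnS (leq_trans IH)// leq_addr.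
  exact: leq_trans (leq_addl _ _) (phi_ge _).
exists X; split => // q q1.
have [M hM] := key q 1 q1 ltr01.
have [C hC] := LS M q q1.
exists (C + 1); apply: Lnorm_le_eq (Lnorm_leB q1 hC (hM M (leqnn _))).
by move=> w; rewrite subKr.
Qed.

End Lq_bounds.

(** * Young integration in every Lq *)

Section Young.
Context d (Omega : measurableType d) (R : realType) (P : probability Omega R).
Variable a : R.
Hypothesis a_gt : 1 / 2 < a.
Implicit Types (f g : R -> Omega -> R) (q C D : R) (x : nat -> R).

Definition holder_le q f C := forall s t, Lnorm_le P q (fun w => f t w - f s w) (C * `|t - s| `^ a).

(** The solution [K] of [2 * K * 2^(-2 * a) + 2 * C * D = K], the equation that
makes the induction of [young_bound] close. *)
Definition young_const C D := 2 * (C * D) / (1 - 2 `^ (1 - 2 * a)).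

Lemma powR2_lt1 : 2 `^ (1 - 2 * a) < 1 :> R.
Proof.
rewrite -[ltRHS](powRr0 2) /powR ifF ?ifF; first last.
- by apply/negbTE; rewrite pnatr_eq0.
- by apply/negbTE; rewrite pnatr_eq0.
rewrite ltr_expR ltr_pM2r; first by move: a_gt; lra.
by rewrite ln_gt0// ltr1n.
Qed.

Lemma young_const_ge0 C D : 0 <= C -> 0 <= D -> 0 <= young_const C D.
Proof.
move=> C0 D0; rewrite /young_const divr_ge0 ?mulr_ge0//.
by rewrite subr_ge0 ltW// powR2_lt1.
Qed.

Lemma young_const_eq C D L : 0 <= L ->
  young_const C D * (L / 2) `^ (2 * a) + young_const C D * (L / 2) `^ (2 * a) +
    2 * (C * D) * L `^ (2 * a) = young_const C D * L `^ (2 * a).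
Proof.
move=> L0.
rewrite powRM// -powR_inv1// -powRrM mulN1r.
have r1 := powR2_lt1; have r0 : 1 - 2 `^ (1 - 2 * a) != 0 :> R by rewrite subr_eq0 eq_sym lt_eqF.
have -> : 2 `^ (- (2 * a)) = 2 `^ (1 - 2 * a) / 2 :> R.
  by rewrite powRD ?pnatr_eq0 ?implybT// powRr1// [RHS]mulrC mulKf// pnatr_eq0.
rewrite /young_const; field; exact: r0.
Qed.

Lemma powR_mul_le u v L : 0 <= u -> u <= L -> 0 <= v -> v <= L ->
  (u `^ a) * (v `^ a) <= L `^ (2 * a).
Proof.
move=> u0 uL v0 vL.
have a0 : 0 < a by move: a_gt; lra.
have -> : 2 * a = a + a by ring.
rewrite powRD; last by apply/implyP => /eqP; lra.
by apply: ler_pM; rewrite ?powR_ge0//; apply: ge0_ler_powR; rewrite ?nnegrE//; lra.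
Qed.

Definition stieltjes_sum f g x i j : Omega -> R :=
  fun w => \sum_(i <= k < j) f (x k) w * (g (x k.+1) w - g (x k) w).

Lemma holder_le_ge0 q f C : holder_le q f C -> 0 <= C.
Proof. by move=> /(_ 0 1)/Lnorm_le_ge0; rewrite subr0 normr1 powR1 mulr1. Qed.

(** Let [L] be the length of the interval and [x (i + m)] the last point at
distance at most [L / 2] from its left end.  The sums to the left of
[x (i + m)] and to the right of [x (i + m).+1] run over lengths at most
[L / 2] and are bounded by induction; exchanging [f (x (i + m))] and
[f (x (i + m).+1)] for [f (x i)] costs two products of increments of [f] and
[g]. *)
Lemma young_bound q f g C D x : 1 <= q -> holder_le (2 * q) f C -> holder_le (2 * q) g D ->
  (forall k, x k <= x k.+1) -> forall n i,
  Lnorm_le P q (fun w => stieltjes_sum f g x i (i + n) w - f (x i) w * (g (x (i + n)%N) w - g (x i) w))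
    (young_const C D * (x (i + n)%N - x i) `^ (2 * a)).
Proof.
move=> q1 hf hg xS; have C0 := holder_le_ge0 hf; have D0 := holder_le_ge0 hg.
have q0 : 0 < q by lra.
have K0 := young_const_ge0 C0 D0; have a0 := a_gt.
have xmono : {homo x : i j / (i <= j)%N >-> i <= j} by apply/nondecreasing_seqP.
elim/ltn_ind => n IH i; set L := x (i + n)%N - x i.
have L0 : 0 <= L by rewrite subr_ge0 xmono// leq_addr.
case: (posnP n) => [n0|n0].
  rewrite /L n0 addn0; apply: Lnorm_le_eq (Lnorm_le0 _ q0 _).
    by move=> w; rewrite /stieltjes_sum big_geq// subrr mulr0 subr0.
  by rewrite mulr_ge0// powR_ge0.
pose Q m := (m < n)%N && (x (i + m)%N - x i <= L / 2).
have exQ : exists m, Q m by exists 0%N; rewrite /Q n0 addn0 subrr divr_ge0.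
have Qle m : Q m -> (m <= n)%N by case/andP => /ltnW.
case: (ex_maxnP exQ Qle) => m /andP[mn xm] mmax.
pose n' := (n - m.+1)%N.
have nE : (i + n = i + m.+1 + n')%N by rewrite /n' -addnA subnKC.
have xm1 : x (i + n)%N - x (i + m.+1)%N <= L / 2.
  have [m1n|nm1] := ltnP m.+1 n.
    have : ~~ Q m.+1 by apply/negP => /mmax; rewrite ltnn.
    rewrite /Q m1n/= -ltNge /L; lra.
  have -> : (m.+1 = n)%N by apply/eqP; rewrite eqn_leq mn nm1.
  by rewrite subrr divr_ge0.
have b1 := IH m mn i.
have n'n : (n' < n)%N by rewrite ltn_subrL.
have b2 := IH n' n'n (i + m.+1)%N.
rewrite -nE in b2.
have b3 := Lnorm_leM q0 (hf (x i) (x (i + m)%N)) (hg (x (i + m)%N) (x (i + m).+1)).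
have b4 := Lnorm_leM q0 (hf (x i) (x (i + m).+1)) (hg (x (i + m).+1) (x (i + n)%N)).
apply: Lnorm_le_eq (Lnorm_le_weak _ (Lnorm_leD q1 (Lnorm_leD q1 b1 b2) (Lnorm_leD q1 b3 b4))).
  move=> w; rewrite /stieltjes_sum.
  have e1 : (i <= i + m)%N by apply: leq_addr.
  have e2 : (i + m <= i + n)%N by rewrite leq_add2l ltnW.
  rewrite [X in _ = X - _](big_cat_nat e1 e2)/=.
  rewrite [X in _ = _ + X - _]big_ltn ?ltn_add2l//.
  rewrite !addnS.
  ring.
have x0 k l : (k <= l)%N -> 0 <= x l - x k by move=> /xmono; rewrite subr_ge0.
have xl k l : (i <= k)%N -> (k <= l)%N -> (l <= i + n)%N -> `|x l - x k| <= L.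
  move=> ik kl ln; rewrite ger0_norm ?x0// /L lerB// xmono//.
rewrite -(young_const_eq C D L0); apply: lerD; first apply: lerD.
- apply: ler_wpM2l => //; apply: ge0_ler_powR => //; rewrite ?nnegrE; first lra.
    by apply: x0; rewrite leq_addr.
  by rewrite divr_ge0.
- apply: ler_wpM2l => //; apply: ge0_ler_powR => //; rewrite ?nnegrE; first lra.
    by apply: x0; rewrite leq_add2l.
  by rewrite divr_ge0.
rewrite [2 * (C * D)]mulr_natl mulr2n mulrDl; apply: lerD.
  rewrite mulrACA; apply: ler_wpM2l; first exact: mulr_ge0.
  apply: powR_mul_le => //; apply: xl; rewrite ?leq_addr ?leq_add2l// ?(ltnW mn)//.
  by rewrite -addnS leq_add2l.
rewrite mulrACA; apply: ler_wpM2l; first exact: mulr_ge0.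
by apply: powR_mul_le => //; apply: xl; rewrite -?addnS ?leq_addr ?leq_add2l.
Qed.

Variable T : R.
Hypothesis T0 : 0 < T.

Definition grid l k : R := k%:R * T / l%:R.

Lemma riemann_sumE f g l w :
  riemann_sum T f g l w = stieltjes_sum f g (grid l) 0 l w.
Proof. by rewrite /riemann_sum /stieltjes_sum big_mkord. Qed.

Lemma gridS l k : grid l k.+1 = grid l k + T / l%:R.
Proof. by rewrite /grid -natr1 mulrDl mul1r mulrDl. Qed.

Lemma grid_le l k : grid l k <= grid l k.+1.
Proof. by rewrite gridS lerDl divr_ge0// ltW. Qed.

Lemma grid0 l : grid l 0 = 0. Proof. by rewrite /grid !mul0r. Qed.

Lemma gridl l : (0 < l)%N -> grid l l = T.
Proof. by move=> l0; rewrite /grid mulrC mulKf// pnatr_eq0 -lt0n. Qed.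

Lemma gridM l l' k : (0 < l)%N -> (0 < l')%N -> grid (l * l') (k * l') = grid l k.
Proof.
move=> l0 l'0; rewrite /grid !natrM; field.
by rewrite !pnatr_eq0 -!lt0n l0 l'0.
Qed.

Lemma big_nat_blocks (F : nat -> R) l m :
  \sum_(0 <= k < l * m) F k = \sum_(0 <= i < l) \sum_(i * m <= k < i * m + m) F k.
Proof.
elim: l => [|l IH]; first by rewrite mul0n !big_geq.
rewrite big_nat_recr//= -IH mulSnr.
by rewrite (big_cat_nat (leq0n _) (leq_addr _ _)).
Qed.

(** Each of the [l] cells contributes an error of order [(T / l)^(2 * a)]. *)
Lemma young_refine q f g C D l m : 1 <= q -> holder_le (2 * q) f C -> holder_le (2 * q) g D ->
  (0 < l)%N -> (0 < m)%N ->
  Lnorm_le P q (fun w => riemann_sum T f g (l * m) w - riemann_sum T f g l w)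
    (young_const C D * T `^ (2 * a) * l%:R `^ (1 - 2 * a)).
Proof.
move=> q1 hf hg l0 m0.
have b i := young_bound q1 hf hg (@grid_le (l * m)%N) m (i * m)%N.
apply: Lnorm_le_eq (Lnorm_le_weak _ (Lnorm_le_sum (index_iota 0 l) q1 b)).
  move=> w; rewrite !riemann_sumE /stieltjes_sum big_nat_blocks sumrB; congr (_ - _).
  by apply: eq_bigr => i _; rewrite -mulSnr !gridM.
rewrite (eq_bigr (fun=> young_const C D * (T / l%:R) `^ (2 * a))).
  have l0' : 0 < l%:R :> R by rewrite ltr0n.
  rewrite sumr_const_nat subn0 -[_ *+ l]mulr_natr powRM ?invr_ge0 ?(ltW T0) ?(ltW l0')//.
  rewrite -powR_inv1 ?(ltW l0')// -powRrM mulN1r powRD ?pnatr_eq0 -?lt0n ?l0 ?implybT//.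
  rewrite powRr1 ?(ltW l0')//.
  by rewrite le_eqVlt; apply/orP; left; apply/eqP; ring.
by move=> i _; rewrite -mulSnr !gridM// gridS addrC addKr.
Qed.

Definition holder f := (forall t, Lall P (f t)) /\
  forall q, 1 <= q -> exists C, holder_le q f C.

Lemma powR_inv_small (b c e : R) : 0 < b -> 0 < e -> 0 <= c ->
  exists N, forall n, (N <= n)%N -> (0 < n)%N -> c * n%:R `^ (- b) <= e.
Proof.
move=> b0 e0 c0.
(* [c * n^(- b) <= e] holds as soon as [n >= x] *)
pose x := (c / e) `^ b^-1.
exists (Num.truncn x).+1 => n Nn n0.
have nx : x <= n%:R.
  apply/ltW/(lt_le_trans (truncnS_gt x)).
  by rewrite ler_nat.
have x0 : 0 <= c / e by rewrite divr_ge0// ltW.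
have : c / e <= n%:R `^ b.
  have -> : c / e = x `^ b by rewrite /x -powRrM mulVf ?gt_eqF// powRr1.
  by apply: ge0_ler_powR; rewrite ?nnegrE ?powR_ge0 ?ler0n// ltW.
rewrite powRN ler_pdivrMr// => h.
by rewrite ler_pdivrMr ?powR_gt0 ?ltr0n// mulrC.
Qed.

(** The sums on the grids with [l] and [m] cells are both compared with the sum
on the grid with [l * m] cells. *)
Lemma young_exists f g : holder f -> holder g ->
  exists X, Lall P X /\ cvg_Lall P (riemann_sum T f g) X.
Proof.
move=> [Lf Hf] [Lg Hg].
apply: Lall_complete => [l|q e q1 e0].
  by rewrite /riemann_sum; apply: Lall_sum => k; apply: LallM => //; apply: LallB.
have q2 : 1 <= 2 * q by lra.
have [C hC] := Hf _ q2; have [D hD] := Hg _ q2.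
have c0 : 0 <= young_const C D * T `^ (2 * a).
  by rewrite mulr_ge0 ?powR_ge0// young_const_ge0 ?(holder_le_ge0 hC) ?(holder_le_ge0 hD).
have e20 : 0 < e / 2 by rewrite divr_gt0.
have b0 : 0 < 2 * a - 1 by move: a_gt; lra.
have [N hN] := powR_inv_small b0 e20 c0.
rewrite opprB in hN.
exists N.+1 => l m Nl Nm.
have l0 : (0 < l)%N by apply: leq_trans Nl.
have m0 : (0 < m)%N by apply: leq_trans Nm.
have b1 := young_refine q1 hC hD l0 m0.
have b2 := young_refine q1 hC hD m0 l0.
apply: Lnorm_le_eq (Lnorm_le_weak _ (Lnorm_leB q1 b2 b1)).
  by move=> w; rewrite (mulnC m l); ring.
rewrite [leRHS]splitr; apply: lerD; apply: hN => //; exact: ltnW.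
Qed.

End Young.

Section Limits.
Context d (Omega : measurableType d) (R : realType) (P : probability Omega R).
Implicit Types (S : nat -> Omega -> R) (X Y : Omega -> R).

Lemma cvg_Lall_ext S S' X : (forall l w, (0 < l)%N -> S l w = S' l w) ->
  cvg_Lall P S X -> cvg_Lall P S' X.
Proof.
move=> SS h q e q1 e0; have [N hN] := h q e q1 e0.
exists N.+1 => n Nn; apply: Lnorm_le_eq (hN n (ltnW Nn)) => w.
by rewrite SS// (leq_ltn_trans _ Nn).
Qed.

Lemma cvg_LallD S S' X Y : cvg_Lall P S X -> cvg_Lall P S' Y ->
  cvg_Lall P (fun l w => S l w + S' l w) (fun w => X w + Y w).
Proof.
move=> h h' q e q1 e0; have e20 : 0 < e / 2 by rewrite divr_gt0.
have [N hN] := h q _ q1 e20; have [N' hN'] := h' q _ q1 e20.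
exists (maxn N N') => n; rewrite geq_max => /andP[Nn N'n].
rewrite [X in Lnorm_le _ _ _ X]splitr; apply: Lnorm_le_eq (Lnorm_leD q1 (hN n Nn) (hN' n N'n)).
by move=> w; ring.
Qed.

Lemma cvg_LallN S X : cvg_Lall P S X -> cvg_Lall P (fun l w => - S l w) (fun w => - X w).
Proof.
move=> h q e q1 e0; have [N hN] := h q e q1 e0.
exists N => n Nn; apply: Lnorm_le_eq (Lnorm_leN (hN n Nn)) => w; ring.
Qed.

Lemma cvg_LallB S S' X Y : cvg_Lall P S X -> cvg_Lall P S' Y ->
  cvg_Lall P (fun l w => S l w - S' l w) (fun w => X w - Y w).
Proof. by move=> h h'; apply: cvg_LallD h (cvg_LallN h'). Qed.

(** Limits are determined up to null sets only, so a bound on one version has to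
be transported to the others. *)
Lemma cvg_Lall_Lnorm_le q S X Y C : 1 <= q -> cvg_Lall P S X -> cvg_Lall P S Y ->
  Lnorm_le P q Y C -> Lnorm_le P q X C.
Proof.
move=> q1 hX hY bY.
have b e : 0 < e -> Lnorm_le P q X (C + e).
  move=> e0; have e20 : 0 < e / 2 by rewrite divr_gt0.
  have [N hN] := hX q _ q1 e20; have [N' hN'] := hY q _ q1 e20.
  have := Lnorm_leD q1 bY (Lnorm_leB q1 (hN' _ (leq_maxr N N')) (hN _ (leq_maxl N N'))).
  rewrite -splitr; apply: Lnorm_le_eq => w; ring.
split; first by case: (b 1 ltr01).
by apply/lee_addgt0Pr => e /b[_]; rewrite EFinD.
Qed.

End Limits.

Section Clip.
Context (R : realType).
Implicit Types c e u v : R.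
Definition clip c e u := Num.max c (Num.min u e).

Lemma clip_itv c e u : c <= e -> c <= clip c e u <= e.
Proof. by move=> ce; rewrite /clip le_max lexx/= ge_max ce ge_min lexx orbT. Qed.

Lemma clip_id c e u : c <= u <= e -> clip c e u = u.
Proof. by move=> /andP[cu ue]; rewrite /clip min_l// max_r. Qed.

Lemma clip_lo c e u : c <= e -> u <= c -> clip c e u = c.
Proof. by move=> ce uc; rewrite /clip max_l// ge_min uc. Qed.

Lemma clip_hi c e u : c <= e -> e <= u -> clip c e u = e.
Proof. by move=> ce eu; rewrite /clip min_r// max_r. Qed.

Lemma clip_le c e u v : u <= v -> clip c e u <= clip c e v.
Proof. by move=> uv; rewrite /clip ge_max !le_max lexx/= le_min !ge_min uv lexx !orbT. Qed.

Lemma clip_lip c e u v : c <= e -> `|clip c e u - clip c e v| <= `|u - v|.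
Proof.
move=> ce; wlog uv : u v / u <= v.
  by move=> h; have [/h//|/ltW/h] := leP u v; rewrite distrC (distrC v).
rewrite distrC (distrC u) !ger0_norm ?subr_ge0 ?clip_le//.
have [uc|cu] := leP u c.
  rewrite (clip_lo ce uc); have [vc|cv] := leP v c.
    by rewrite (clip_lo ce vc) subrr subr_ge0.
  have [ev|ve] := leP e v; first by rewrite (clip_hi ce ev); lra.
  by rewrite (@clip_id _ _ v) ?(ltW ve) ?(ltW cv)//; lra.
have [eu|ue] := leP e u.
  by rewrite !clip_hi//; [rewrite subrr subr_ge0|exact: le_trans uv].
rewrite (@clip_id _ _ u) ?(ltW cu) ?(ltW ue)//.
have [ev|ve] := leP e v; first by rewrite (clip_hi ce ev); lra.
by rewrite (@clip_id _ _ v) ?(ltW ve) ?(ltW (lt_le_trans cu uv))//; lra.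
Qed.
End Clip.

Section Primitive.
Context d (Omega : measurableType d) (R : realType) (P : probability Omega R).
Variables (a T : R).
Hypothesis a_gt : 1 / 2 < a.
Hypothesis T0 : 0 < T.
Implicit Types (F g : R -> Omega -> R) (q C D c e : R).
Local Notation holder_le := (holder_le P a).
Local Notation holder := (holder P a).
Local Notation young_const := (young_const a).

Lemma holder_le_clip q F C c e : c <= e -> holder_le q F C -> holder_le q (F \o clip c e) C.
Proof.
move=> ce hF s t; apply: Lnorm_le_weak (hF _ _).
rewrite ler_wpM2l ?(holder_le_ge0 hF)//; apply: ge0_ler_powR; rewrite ?nnegrE ?normr_ge0//.
  by move: a_gt; lra.
exact: clip_lip.
Qed.

Lemma holder_clip F c e : c <= e -> holder F -> holder (F \o clip c e).
Proof.
move=> ce [LF HF]; split=> [t|q /HF[C hC]]; first exact: LF.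
by exists C; apply: holder_le_clip.
Qed.

Definition window c e F : R -> Omega -> R := fun u w => (c <= u <= e)%R%:R * F u w.

(** A cell contributes the same to the integral of the windowed [F] against [g]
and to that of the stopped [F] against the stopped [g], unless [c] or [e] lies
in it; the differences of indicators count these two crossings, and telescope
over a grid. *)
Lemma window_clip_term q F g C D M c e u v : 1 <= q -> c <= e -> u <= v ->
  holder_le (2 * q) F C -> holder_le (2 * q) g D -> Lnorm_le P (2 * q) (F c) M ->
  Lnorm_le P q (fun w => window c e F u w * (g v w - g u w)
     - F (clip c e u) w * (g (clip c e v) w - g (clip c e u) w))
   (((c <= v)%R%:R - (c <= u)%R%:R + ((e < v)%R%:R - (e < u)%R%:R)) *
     (2 * ((M + C * (e - c) `^ a) * (D * (v - u) `^ a)))).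
Proof.
move=> q1 ce uv hF hg bM.
have q0 : 0 < q by lra.
have C0 := holder_le_ge0 hF; have D0 := holder_le_ge0 hg; have M0 := Lnorm_le_ge0 bM.
have q21 : 1 <= 2 * q by lra.
set K := (M + _) * _.
have K0 : 0 <= K by rewrite !mulr_ge0 ?addr_ge0 ?mulr_ge0 ?powR_ge0.
have bF s : Lnorm_le P (2 * q) (F (clip c e s)) (M + C * (e - c) `^ a).
  apply: Lnorm_le_eq (Lnorm_le_weak _ (Lnorm_leD q21 bM (hF c (clip c e s)))).
    by move=> w; rewrite subrKC.
  rewrite lerD2l ler_wpM2l//; apply: ge0_ler_powR; rewrite ?nnegrE ?normr_ge0 ?subr_ge0//.
    by move: a_gt; lra.
  have /andP[h1 h2] := clip_itv s ce.
  by rewrite ger0_norm ?subr_ge0// lerD2r.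
have bg s t : `|t - s| <= v - u ->
   Lnorm_le P (2 * q) (fun w => g t w - g s w) (D * (v - u) `^ a).
  move=> h; apply: Lnorm_le_weak (hg s t); rewrite ler_wpM2l//.
  apply: ge0_ler_powR; rewrite ?nnegrE ?normr_ge0 ?subr_ge0//.
  by move: a_gt; lra.
have b2 : Lnorm_le P q (fun w => F (clip c e u) w * (g (clip c e v) w - g (clip c e u) w)) K.
  apply: Lnorm_leM => //; apply: bg; apply: le_trans (clip_lip _ _ ce) _.
  by rewrite ger0_norm ?subr_ge0.
have b1 : Lnorm_le P q (fun w => window c e F u w * (g v w - g u w)) K.
  rewrite /window; have [/clip_id ue|_] := boolP (c <= u <= e).
    apply: Lnorm_le_eq (Lnorm_leM q0 (bF u) (bg u v _)).
      by move=> w; rewrite mul1r ue.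
    by rewrite ger0_norm ?subr_ge0.
  by apply: Lnorm_le_eq (Lnorm_le0 P q0 K0) => w; rewrite !mul0r.
have b12 : Lnorm_le P q (fun w => window c e F u w * (g v w - g u w)
     - F (clip c e u) w * (g (clip c e v) w - g (clip c e u) w)) (2 * K).
  by apply: Lnorm_le_weak (Lnorm_leB q1 b1 b2); rewrite mulr_natl mulr2n.
have K20 : 0 <= 2 * K by rewrite (mulr_ge0 _ K0).
have z : (forall w, window c e F u w * (g v w - g u w) =
    F (clip c e u) w * (g (clip c e v) w - g (clip c e u) w)) -> 
   forall k : R, 0 <= k -> Lnorm_le P q (fun w => window c e F u w * (g v w - g u w)
     - F (clip c e u) w * (g (clip c e v) w - g (clip c e u) w)) (k * (2 * K)).
  move=> h k k0; apply: Lnorm_le_eq (Lnorm_le0 P q0 _); last by rewrite (mulr_ge0 k0).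
  by move=> w; rewrite h subrr.
have [cu|uc] := leP c u.
  rewrite (le_trans cu uv) subrr add0r.
  have [eu|ue] := ltP e u.
    rewrite (lt_le_trans eu uv) subrr; apply: z => // w.
    have ev := lt_le_trans eu uv.
    rewrite /window (leNgt u) eu andbF mul0r !clip_hi ?(ltW eu) ?(ltW ev)//.
    by rewrite mul0r subrr mulr0.
  have [ev|ve] := ltP e v; first by rewrite subr0 mul1r.
  rewrite subrr; apply: z => // w; rewrite /window cu ue mul1r !clip_id//.
    by rewrite ve (le_trans cu).
  by rewrite cu.
have [eu|ue] := ltP e u; first by move: (lt_trans eu uc); rewrite ltNge ce.
have [cv|vc] := leP c v.
  by rewrite subr0; apply: Lnorm_le_weak b12; rewrite ler_peMl// subr0 lerDl.
have -> : (e < v) = false by apply/negbTE; rewrite -leNgt (ltW (lt_le_trans vc ce)).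
rewrite !subrr addr0; apply: z => // w.
by rewrite /window (leNgt c) uc mul0r !clip_lo ?(ltW uc) ?(ltW vc)// mul0r subrr mulr0.
Qed.

(** The windowed integrand has jumps at [c] and [e], but these touch at most two
cells, each with an increment of [g] of order [(T / l)^a].  So its integral is
that of the stopped processes, which are Hoelder. *)
Lemma window_clip F g c e : holder F -> holder g -> 0 <= c -> c <= e -> e <= T ->
  cvg_Lall P (fun l w => riemann_sum T (window c e F) g l w
     - riemann_sum T (F \o clip c e) (g \o clip c e) l w) (fun=> 0).
Proof.
move=> [LF HF] [Lg Hg] c0 ce eT q eps q1 eps0.
have q21 : 1 <= 2 * q by lra.
have [C hC] := HF _ q21; have [D hD] := Hg _ q21; have [M hM] := LF c _ q21.
pose K := 4 * (M + C * (e - c) `^ a) * D * T `^ a.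
have K0 : 0 <= K.
  by rewrite !mulr_ge0 ?addr_ge0 ?mulr_ge0 ?powR_ge0 ?(holder_le_ge0 hC) ?(holder_le_ge0 hD) ?(Lnorm_le_ge0 hM).
have a0 : 0 < a by move: a_gt; lra.
have [N hN] := powR_inv_small a0 eps0 K0.
exists N.+1 => l Nl; have l0 : (0 < l)%N by apply: leq_trans Nl.
apply: Lnorm_le_weak (hN l (ltnW Nl) l0) _.
have l0' : 0 < l%:R :> R by rewrite ltr0n.
have b k := window_clip_term q1 ce (grid_le T0 l k) hC hD hM.
apply: Lnorm_le_eq (Lnorm_le_weak _ (Lnorm_le_sum (index_iota 0 l) q1 b)).
  by move=> w; rewrite !riemann_sumE /stieltjes_sum subr0 sumrB.
have hE k : grid T l k.+1 - grid T l k = T / l%:R by rewrite gridS addrC addKr.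
under eq_bigr do rewrite hE.
rewrite -mulr_suml big_split/= !telescope_sumr//.
rewrite powRM ?invr_ge0 ?(ltW T0) ?(ltW l0')//.
rewrite -powR_inv1 ?(ltW l0')// -powRrM mulN1r.
set X := l%:R `^ (- a).
have -> : K * X = 2 * (2 * ((M + C * (e - c) `^ a) * (D * (T `^ a * X)))).
  by rewrite /K; ring.
apply: ler_wpM2r.
  by rewrite !mulr_ge0 ?addr_ge0 ?mulr_ge0 ?powR_ge0 ?(holder_le_ge0 hC) ?(holder_le_ge0 hD) ?(Lnorm_le_ge0 hM).
have h (x y : bool) : x%:R - y%:R <= 1 :> R by case: x; case: y => /=; lra.
have := h (c <= grid T l l) (c <= grid T l 0).
have := h (e < grid T l l) (e < grid T l 0).
lra.
Qed.

(** The bound is that of [young_bound] on [[c, e]] plus the norm of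
[F c * (g e - g c)]; it makes the integral Hoelder in its end points. *)
Lemma window_integral F g c e : holder F -> holder g -> 0 <= c -> c <= e -> e <= T ->
  exists X, [/\ Lall P X, cvg_Lall P (riemann_sum T (window c e F) g) X &
    forall q C D M, 1 <= q -> holder_le (2 * q) F C -> holder_le (2 * q) g D ->
      Lnorm_le P (2 * q) (F c) M ->
      Lnorm_le P q X (young_const C D * (e - c) `^ (2 * a) + M * (D * (e - c) `^ a))].
Proof.
move=> HF Hg c0 ce eT.
have [X [LX hX]] := young_exists a_gt T0 (holder_clip ce HF) (holder_clip ce Hg).
exists X; split => //.
  have := cvg_LallD (window_clip HF Hg c0 ce eT) hX.
  rewrite (_ : (fun w => 0 + X w) = X); last by apply/funext => w; rewrite add0r.
  by apply: cvg_Lall_ext => l w _; rewrite subrK.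
move=> q C D M q1 hC hD bM.
apply: (Lnorm_le_lim q1 _ hX) => l l0.
pose x k := clip c e (grid T l k).
have xS k : x k <= x k.+1 by apply/clip_le/grid_le.
have := young_bound a_gt q1 hC hD xS l 0.
have x0 : x 0%N = c by rewrite /x grid0 clip_lo.
have xl : x l = e by rewrite /x gridl// clip_hi.
rewrite add0n xl x0 => b.
have bg : Lnorm_le P (2 * q) (fun w => g e w - g c w) (D * (e - c) `^ a).
  by have := hD c e; rewrite ger0_norm ?subr_ge0.
have q0 : 0 < q by lra.
apply: Lnorm_le_eq (Lnorm_leD q1 b (Lnorm_leM q0 bM bg)) => w.
by rewrite subrK riemann_sumE /stieltjes_sum.
Qed.

(** [V t - V s] is an integral over [[s, t]], so [window_integral] bounds it by a
multiple of [|t - s|^a].  This turns the inner integral over a simplex into an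
admissible integrand for the next one. *)
Lemma primitive_exists F g c e : holder F -> holder g -> 0 <= c -> c <= e -> e <= T ->
  exists V, holder V /\
    forall t, c <= t <= e -> cvg_Lall P (riemann_sum T (window c t F) g) (V t).
Proof.
move=> HF Hg c0 ce eT.
have ex t : exists X, Lall P X /\ cvg_Lall P (riemann_sum T (window c (clip c e t) F) g) X.
  have /andP[h1 h2] := clip_itv t ce.
  have [X [LX hX _]] := window_integral HF Hg c0 h1 (le_trans h2 eT).
  by exists X.
have [V hV] := choice ex.
exists V; split; last by move=> t /clip_id tE; have := (hV t).2; rewrite tE.
split=> [t|q q1]; first exact: (hV _).1.
have q21 : 1 <= 2 * q by lra.
have [C hC] := HF.2 _ q21; have [D hD] := Hg.2 _ q21; have [M hM] := HF.1 c _ q21.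
pose M' := M + C * (e - c) `^ a.
have a0 : 0 < a by move: a_gt; lra.
have C0 := holder_le_ge0 hC; have D0 := holder_le_ge0 hD; have M0 := Lnorm_le_ge0 hM.
have bF t : c <= t <= e -> Lnorm_le P (2 * q) (F t) M'.
  move=> /andP[ct te].
  apply: Lnorm_le_eq (Lnorm_le_weak _ (Lnorm_leD q21 hM (hC c t))).
    by move=> w; rewrite subrKC.
  rewrite lerD2l ler_wpM2l//; apply: ge0_ler_powR; rewrite ?nnegrE ?normr_ge0 ?subr_ge0//.
    exact: ltW.
  by rewrite ger0_norm ?subr_ge0// lerD2r.
have M'0 : 0 <= M' by rewrite addr_ge0// mulr_ge0// powR_ge0.
exists (young_const C D * (e - c) `^ a + M' * D) => s t.
wlog st : s t / s <= t.
  move=> h; have [/h//|/ltW/h b] := leP s t.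
  by rewrite distrC; apply: Lnorm_le_eq (Lnorm_leN b) => w; rewrite opprB.
have /andP[s1 s2] := clip_itv s ce; have /andP[t1 t2] := clip_itv t ce.
have st' := clip_le c e st.
set s' := clip c e s in s1 s2 st' *; set t' := clip c e t in t1 t2 st' *.
have [X1 [L1 h1 b1]] := window_integral HF Hg (le_trans c0 s1) st' (le_trans t2 eT).
have [X2 [L2 h2 b2]] := window_integral HF Hg (le_trans c0 s1) (lexx s') (le_trans s2 eT).
have bFs : Lnorm_le P (2 * q) (F s') M' by apply: bF; rewrite s1.
have {}b1 := b1 _ _ _ _ q1 hC hD bFs.
have {}b2 := b2 _ _ _ _ q1 hC hD bFs.
rewrite subrr !powR0 ?gt_eqF ?mulr_gt0// !mulr0 addr0 in b2.
have b3 : Lnorm_le P q (fun w => V t w - V s w)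
     (young_const C D * (t' - s') `^ (2 * a) + M' * (D * (t' - s') `^ a)).
  rewrite -[X in Lnorm_le _ _ _ X]addr0.
  apply: (cvg_Lall_Lnorm_le q1 (cvg_LallB (hV t).2 (hV s).2) _ (Lnorm_leB q1 b1 b2)).
  apply: cvg_Lall_ext (cvg_LallB h1 h2) => l w _.
  rewrite /riemann_sum -!sumrB; apply: eq_bigr => k _.
  rewrite /window -!mulrA -!mulrBl; congr (_ * _).
  rewrite -/s' -/t'; set u := _ * (T / _); rewrite -/t'.
  have [cu|uc] := leP c u => /=; last first.
    have -> : (s' <= u) = false by apply/negbTE; rewrite -ltNge (lt_le_trans uc).
    by [].
  have [us|su] := leP u s' => /=.
    by rewrite (le_trans us st') !andbT !subrr.
  by rewrite (ltW su) /= !subr0.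
apply: Lnorm_le_weak b3.
have y0 : 0 <= young_const C D by apply: young_const_ge0.
have ts : t' - s' <= `|t - s|.
  by rewrite -[leLHS]ger0_norm ?subr_ge0// clip_lip.
move: (young_const C D) y0 => Y Y0.
rewrite [leRHS]mulrDl -!mulrA; apply: lerD; apply: ler_wpM2l => //.
  have -> : 2 * a = a + a by ring.
  rewrite powRD; last by apply/implyP => /eqP; move: a_gt; lra.
  apply: ler_pM; rewrite ?powR_ge0//; apply: ge0_ler_powR; rewrite ?nnegrE ?subr_ge0 ?normr_ge0//;
   rewrite ?(ltW a0)//; lra.
apply: ler_wpM2l => //; apply: ge0_ler_powR; rewrite ?nnegrE ?subr_ge0 ?normr_ge0//.
exact: ltW.
Qed.

End Primitive.

(** * Iterated integrals *)

Section IteratedIntegrals.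
Context d (Omega : measurableType d) (R : realType) (P : probability Omega R).
Variable T : R.
Implicit Types (f g : R -> Omega -> R) (X J : Omega -> R).

Definition RS_Lall f g X := [/\ Lall P X,
  forall u, u \in `[0, T] -> Lall P (f u) & cvg_Lall P (riemann_sum T f g) X].

(** Convergence in every Lq at each stage: the value of an inner integral is
multiplied by increments at the next stage, which would lower the exponent if
a single Lq were kept. *)
Fixpoint iter_Lall (r : nat) : ('I_r -> R -> Omega -> R) ->
    (r.-tuple R -> Omega -> R) -> (Omega -> R) -> Prop :=
  match r with
  | 0 => fun _ phi J => J = phi [tuple]
  | q.+1 => fun B phi J => exists psi : q.-tuple R -> Omega -> R,
      (forall s : q.-tuple R, cube 0 T s ->
         RS_Lall (fun u => phi [tuple of u :: s]) (B ord0) (psi s)) /\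
      iter_Lall (fun i => B (lift ord0 i)) psi J
  end.

Lemma cvg0_ereal (u : nat -> \bar R) : (forall n, 0 <= u n)%E ->
  (forall e : R, 0 < e -> exists N, forall n, (N <= n)%N -> (u n <= e%:E)%E) ->
  u @ \oo --> 0%E.
Proof.
move=> u0 h; apply/fine_cvgP; split.
  have [N hN] := h 1 ltr01; exists N => // n /hN un.
  by rewrite ge0_fin_numE//; apply: le_lt_trans un _; rewrite ltry.
apply/cvgrPdist_le => e e0; have [N hN] := h e e0; exists N => // n /hN un /=.
rewrite sub0r normrN ger0_norm ?fine_ge0// -lee_fin fineK//.
by rewrite ge0_fin_numE//; apply: le_lt_trans un _; rewrite ltry.
Qed.

Lemma cvg0_erealP (u : nat -> \bar R) (e : R) : (forall n, 0 <= u n)%E ->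
  u @ \oo --> 0%E -> 0 < e ->
  exists N, forall n, (N <= n)%N -> (u n <= e%:E)%E.
Proof.
move=> u0 /fine_cvgP[[N _ hN] /cvgrPdist_le h] e0.
have [M _ hM] := h e e0; exists (maxn N M) => n; rewrite geq_max => /andP[Nn Mn].
have := hM n Mn; rewrite /= sub0r normrN ger0_norm ?fine_ge0// => he.
by rewrite -(fineK (hN n Nn)) lee_fin.
Qed.

Lemma RS_Lall_RS p f g X : 1 <= p -> (forall u, u \in `[0, T] -> Lall P (g u)) ->
  RS_Lall f g X -> is_RS_integral P p T f g X.
Proof.
move=> p1 Lg [LX Lf h]; split.
- by move=> u uT; apply: Lall_Lfun => //; apply: Lf.
- by move=> u uT; apply: Lall_Lfun => //; apply: Lg.
- exact: Lall_Lfun.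
apply: cvg0_ereal => [n|e e0]; first exact: Lnorm_ge0.
by have [N hN] := h p e p1 e0; exists N => n /hN[].
Qed.

Lemma iter_Lall_iterated p r (B : 'I_r -> R -> Omega -> R) phi J : 1 <= p ->
  (forall i u, u \in `[0, T] -> Lall P (B i u)) ->
  iter_Lall B phi J -> is_iterated_integral P p T B phi J.
Proof.
move=> p1; elim: r B phi => [//|r IH] B phi LB [psi [h1 h2]].
exists psi; split; last by apply: IH => // i u; apply: LB.
move=> s /h1; apply: RS_Lall_RS => //; exact: LB.
Qed.

Lemma cubeP r c e u (s : r.-tuple R) :
  cube c e [tuple of u :: s] <-> (c <= u <= e) /\ cube c e s.
Proof.
split=> [h|[h1 h2] i].
  split; first by have := h ord0; rewrite /= (tnth_nth 0)/= in_itv.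
  by move=> i; have := h (lift ord0 i); rewrite tnthS.
case: (unliftP ord0 i) => [j|] ->; first by rewrite tnthS; apply: h2.
by rewrite (tnth_nth 0)/= in_itv.
Qed.

Hypothesis T0 : 0 < T.

Lemma grid_in l k : (k <= l)%N -> (0 < l)%N -> grid T l k \in `[0, T].
Proof.
move=> kl l0; rewrite in_itv/= /grid.
have l0' : 0 < l%:R :> R by rewrite ltr0n.
rewrite divr_ge0 ?mulr_ge0 ?(ltW T0) ?ler0n//=.
by rewrite ler_pdivrMr// mulrC ler_pM2l// ler_nat.
Qed.

Lemma riemann_sum_ext f f' g g' l : (0 < l)%N ->
  (forall u, u \in `[0, T] -> f u = f' u) ->
  (forall u, u \in `[0, T] -> g u = g' u) ->
  riemann_sum T f g l = riemann_sum T f' g' l.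
Proof.
move=> l0 ff gg; apply/funext => w; apply: eq_bigr => k _.
by rewrite ff ?gg//; apply: grid_in => //; apply: ltnW.
Qed.

Lemma RS_Lall_ext f f' g g' X :
  (forall u, u \in `[0, T] -> f u = f' u) ->
  (forall u, u \in `[0, T] -> g u = g' u) ->
  RS_Lall f g X -> RS_Lall f' g' X.
Proof.
move=> ff gg [LX Lf h]; split=> //; first by move=> u uT; rewrite -ff//; apply: Lf.
by apply: cvg_Lall_ext h => l w l0; rewrite (riemann_sum_ext l0 ff gg).
Qed.

Lemma iter_Lall_ext r (B B' : 'I_r -> R -> Omega -> R) phi phi' J :
  (forall i u, u \in `[0, T] -> B i u = B' i u) ->
  (forall s, cube 0 T s -> phi s = phi' s) ->
  iter_Lall B phi J -> iter_Lall B' phi' J.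
Proof.
elim: r B B' phi phi' => [|r IH] B B' phi phi' BB ff /=.
  by move=> ->; apply: ff => i; case: i.
move=> [psi [h1 h2]]; exists psi; split.
  move=> s cs; apply: RS_Lall_ext (h1 s cs); last exact: BB.
  by move=> u uT; apply: ff; apply/cubeP; split=> //; move: uT; rewrite in_itv.
by apply: IH h2 => // i u; apply: BB.
Qed.

Lemma Lnorm_leZ_small q c X e : 1 <= q -> Lnorm_le P q X (e / (`|c| + 1)) -> Lnorm_le P q (fun w => c * X w) e.
Proof.
move=> q1 bX; have c1 : 0 < `|c| + 1 by rewrite ltr_wpDl.
apply: Lnorm_le_weak (Lnorm_leZ c q1 bX).
have := Lnorm_le_ge0 bX; rewrite pmulr_lge0 ?invr_gt0// => e0.
by rewrite mulrCA ler_piMr// ler_pdivrMr// mul1r lerDl.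
Qed.

Lemma cvg_LallZ S X c : cvg_Lall P S X -> cvg_Lall P (fun l w => c * S l w) (fun w => c * X w).
Proof.
move=> h q e q1 e0.
have e0' : 0 < e / (`|c| + 1) by rewrite divr_gt0// ltr_wpDl.
have [N hN] := h q _ q1 e0'; exists N => n Nn.
apply: Lnorm_le_eq (Lnorm_leZ_small q1 (hN n Nn)) => w.
by rewrite mulrBr.
Qed.

Lemma LallZ c X : Lall P X -> Lall P (fun w => c * X w).
Proof. by move=> h; apply: LallM => //; apply: Lall_cst. Qed.

Lemma RS_Lall_lin f1 f2 g X1 X2 c : RS_Lall f1 g X1 -> RS_Lall f2 g X2 ->
  RS_Lall (fun u w => f1 u w + c * f2 u w) g (fun w => X1 w + c * X2 w).
Proof.
move=> [L1 F1 h1] [L2 F2 h2]; split.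
- by apply: LallD => //; apply: LallZ.
- by move=> u uT; apply: LallD; [apply: F1|apply: LallZ; apply: F2].
apply: cvg_Lall_ext (cvg_LallD h1 (cvg_LallZ c h2)) => l w _.
rewrite /riemann_sum mulr_sumr -big_split/=; apply: eq_bigr => k _; ring.
Qed.

Lemma iter_Lall_lin r (B : 'I_r -> R -> Omega -> R) phi1 phi2 J1 J2 c :
  iter_Lall B phi1 J1 -> iter_Lall B phi2 J2 ->
  iter_Lall B (fun s w => phi1 s w + c * phi2 s w) (fun w => J1 w + c * J2 w).
Proof.
elim: r B phi1 phi2 => [|r IH] B phi1 phi2 /=; first by move=> -> ->.
move=> [psi1 [h1 k1]] [psi2 [h2 k2]].
exists (fun s w => psi1 s w + c * psi2 s w); split; last exact: IH.
by move=> s cs; apply: RS_Lall_lin; [exact: h1|exact: h2].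
Qed.

(** [Q] is a closed cone that is stable under multiplication by increments, so it
contains the Riemann sums of its elements and their limits, at each of the [r]
stages. *)
Lemma iter_Lall_cone (Q : (Omega -> R) -> Prop) r (B : 'I_r -> R -> Omega -> R) phi J :
  Q (fun=> 0) -> (forall X Y, Q X -> Q Y -> Q (fun w => X w + Y w)) ->
  (forall i u v X, u \in `[0, T] -> v \in `[0, T] -> u <= v ->
    Q X -> Q (fun w => X w * (B i v w - B i u w))) ->
  (forall S X, (forall n, (0 < n)%N -> Q (S n)) -> Lall P X -> cvg_Lall P S X -> Q X) ->
  (forall s, cube 0 T s -> Q (phi s)) -> iter_Lall B phi J -> Q J.
Proof.
move=> Q0 QD + Qlim; elim: r B phi => [|r IH] B phi QM Qphi /=.
  by move=> ->; apply: Qphi => i; case: i.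
move=> [psi [h1 h2]]; apply: IH h2 => [i u v X|s cs]; first exact: QM.
have [LX _ h] := h1 s cs; apply: Qlim h => // l l0.
rewrite /riemann_sum.
suff H (I : seq 'I_l) : Q (fun w => \sum_(k <- I) phi [tuple of grid T l k :: s] w *
   (B ord0 (grid T l k.+1) w - B ord0 (grid T l k) w)) by exact: H.
elim: I => [|k I IHI].
  by rewrite (_ : (fun w => _) = (fun=> 0))//; apply/funext => w; rewrite big_nil.
rewrite (_ : (fun w => _) = (fun w => phi [tuple of grid T l k :: s] w *
   (B ord0 (grid T l k.+1) w - B ord0 (grid T l k) w) +
   \sum_(k <- I) phi [tuple of grid T l k :: s] w *
   (B ord0 (grid T l k.+1) w - B ord0 (grid T l k) w))); last first.
  by apply/funext => w; rewrite big_cons.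
have kT : grid T l k \in `[0, T] by apply: grid_in => //; apply: ltnW.
apply: QD => //; apply: QM => //; [exact: grid_in|exact: grid_le|].
by apply: Qphi; apply/cubeP; split=> //; move: kT; rewrite in_itv.
Qed.

Lemma ae_sum (I : Type) (s : seq I) (X Y : I -> Omega -> R) :
  (forall i, {ae P, forall w, X i w = Y i w}) ->
  {ae P, forall w, \sum_(i <- s) X i w = \sum_(i <- s) Y i w}.
Proof.
move=> h; elim: s => [|i s IH]; first by apply: aeW => w; rewrite !big_nil.
by move: (h i) IH; apply: filterS2 => w h1 h2; rewrite !big_cons h1 h2.
Qed.

Lemma RS_unique p f1 f2 g X1 X2 : 1 <= p ->
  (forall u, u \in `[0, T] -> {ae P, forall w, f1 u w = f2 u w}) ->
  is_RS_integral P p T f1 g X1 -> is_RS_integral P p T f2 g X2 ->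
  {ae P, forall w, X1 w = X2 w}.
Proof.
move=> p1 ff [F1 G L1 h1] [F2 _ L2 h2].
have mL X : X \in Lfun P p%:E -> measurable_fun setT X.
  by rewrite inE => /andP[]; rewrite inE.
have mR f l : (forall u, u \in `[0, T] -> f u \in Lfun P p%:E) -> (0 < l)%N ->
   measurable_fun setT (riemann_sum T f g l).
  move=> Lf l0; apply: measurable_sum => k.
  by apply: measurable_funM; [|apply: measurable_funB]; apply: mL; [apply: Lf|apply: G|apply: G];
   apply: grid_in => //; apply: ltnW.
suff : {ae P, forall w, X1 w - X2 w = 0}.
  by apply: filterS => w /eqP; rewrite subr_eq0 => /eqP.
apply: (@Lnorm_le0_ae _ _ _ P p); first lra.
move=> e e0; have e20 : 0 < e / 2 by rewrite divr_gt0.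
have [N1 hN1] := cvg0_erealP (fun=> Lnorm_ge0 _ _ _) h1 e20.
have [N2 hN2] := cvg0_erealP (fun=> Lnorm_ge0 _ _ _) h2 e20.
pose l := (maxn N1 N2).+1.
have l1 : (N1 <= l)%N by rewrite ltnW// ltnS leq_maxl.
have l2 : (N2 <= l)%N by rewrite ltnW// ltnS leq_maxr.
have b1 : Lnorm_le P p (fun w => riemann_sum T f1 g l w - X1 w) (e / 2).
  split; last exact: hN1.
  by apply: measurable_funB; [exact: mR|exact: mL].
have b2 : Lnorm_le P p (fun w => riemann_sum T f2 g l w - X2 w) (e / 2).
  split; last exact: hN2.
  by apply: measurable_funB; [exact: mR|exact: mL].
rewrite (splitr e); apply: Lnorm_le_ae (Lnorm_leB p1 b2 b1).
  by apply: measurable_funB; exact: mL.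
have : {ae P, forall w, riemann_sum T f1 g l w = riemann_sum T f2 g l w}.
  apply: ae_sum => k; have kT : grid T l k \in `[0, T] by apply: grid_in => //; apply: ltnW.
  by move: (ff _ kT); apply: filterS => w ->.
by apply: filterS => w ->; ring.
Qed.

(** Integrands that agree almost everywhere have Riemann sums that agree almost
everywhere, so versions chosen at an inner stage do not affect the outer ones. *)
Lemma iter_unique p r (B : 'I_r -> R -> Omega -> R) phi1 phi2 J1 J2 : 1 <= p ->
  (forall s, cube 0 T s -> {ae P, forall w, phi1 s w = phi2 s w}) ->
  is_iterated_integral P p T B phi1 J1 -> is_iterated_integral P p T B phi2 J2 ->
  {ae P, forall w, J1 w = J2 w}.
Proof.
move=> p1; elim: r B phi1 phi2 => [|r IH] B phi1 phi2 ff /=.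
  by move=> -> ->; apply: ff => i; case: i.
move=> [psi1 [h1 k1]] [psi2 [h2 k2]]; apply: IH k1 k2 => s cs.
apply: RS_unique p1 _ (h1 s cs) (h2 s cs) => u uT; apply: ff.
by apply/cubeP; split=> //; move: uT; rewrite in_itv.
Qed.

End IteratedIntegrals.

(** * Existence for unions of cubes and of simplices *)

Section Existence.
Context d (Omega : measurableType d) (R : realType) (P : probability Omega R).
Variables (a T : R).
Hypothesis a_gt : 1 / 2 < a.
Hypothesis T0 : 0 < T.
Local Notation holder := (holder P a).
Implicit Types (F g : R -> Omega -> R) (c e : R).

Lemma cube_cons r c e u (s : r.-tuple R) :
  ([tuple of u :: s] \in cube c e) = (c <= u <= e) && (s \in cube c e) :> bool.
Proof.
apply/idP/andP => [/set_mem/cubeP[h1 h2]|[h1 /set_mem h2]].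
  by split=> //; apply/mem_set.
by apply/mem_set/cubeP.
Qed.

Lemma holder_cst (X : Omega -> R) : Lall P X -> holder (fun=> X).
Proof.
move=> LX; split=> // q q1; exists 0 => s t; rewrite mul0r.
by apply: Lnorm_le_eq (Lnorm_le0 _ _ (lexx 0)) => [w|]; [rewrite subrr|lra].
Qed.

Lemma RS_Lall_window (b : bool) f F g X c e : holder F ->
  (forall u, u \in `[0, T] -> f u = fun w => b%:R * window c e F u w) ->
  Lall P X -> cvg_Lall P (riemann_sum T (window c e F) g) X ->
  RS_Lall P T f g (fun w => b%:R * X w).
Proof.
move=> HF fE LX h; split; first exact: LallZ.
  by move=> u uT; rewrite fE//; apply/LallZ/LallZ; apply: HF.1.
apply: cvg_Lall_ext (cvg_LallZ b%:R h) => l w l0.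
rewrite (riemann_sum_ext T0 l0 fE (fun u _ => erefl (g u))).
by rewrite /riemann_sum mulr_sumr; apply: eq_bigr => k _; rewrite mulrA.
Qed.

(** [Z] is the product of the integrals already carried out; it is an integrand
constant in time for the next variable. *)
Lemma cube_integral r (B : 'I_r -> R -> Omega -> R) c e Z :
  (forall i, holder (B i)) -> 0 <= c -> c <= e -> e <= T -> Lall P Z ->
  exists J, Lall P J /\ iter_Lall P T B (fun s w => \1_(cube c e) s * Z w) J.
Proof.
move=> + c0 ce eT; elim: r B Z => [|r IH] B Z HB LZ.
  eexists; split; last by [].
  by apply: LallZ.
have [X [LX hX _]] := window_integral a_gt T0 (holder_cst LZ) (HB ord0) c0 ce eT.
have [J [LJ hJ]] := IH (fun i => B (lift ord0 i)) X (fun i => HB _) LX.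
exists J; split=> //=; exists (fun s w => \1_(cube c e) s * X w); split=> // s cs.
rewrite indicE; apply: RS_Lall_window hX => //; first exact: (holder_cst LZ).
move=> u _; apply/funext => w; rewrite indicE cube_cons /window -mulnb natrM; ring.
Qed.

Lemma simplexE r c e (s : r.-tuple R) : c <= e ->
  simplex T c e s <-> [/\ cube 0 T s, sorted <=%R s & cube c e s].
Proof.
move=> ce; rewrite /simplex; split=> [[h1 /= h2]|[h1 h2 h3]]; split => //.
- apply: (path_sorted (x := c)); move: h2; rewrite -cats1 cat_path => /andP[h2 _].
  exact: h2.
- move=> i; rewrite in_itv/=.
  have /allP h3 := order_path_min (@le_trans _ R) h2.
  have -> /= : c <= tnth s i by apply: h3; rewrite mem_rcons inE mem_tnth orbT.
  have : sorted <=%R (rcons s e) by apply: path_sorted h2.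
  move=> h4.
  have : sorted >=%R (rev (rcons s e)) by rewrite rev_sorted.
  rewrite rev_rcons /= => h5.
  have ge_trans : transitive (>=%R : rel R) by move=> x y z xy /le_trans; apply.
  have /allP := order_path_min ge_trans h5.
  by apply; rewrite mem_rev mem_tnth.
- rewrite /= -cats1 cat_path /=; apply/andP; split.
    rewrite path_sortedE; last exact: le_trans.
    rewrite h2 andbT; apply/allP => x /tnthP[i ->].
    by have := h3 i; rewrite in_itv => /andP[].
  rewrite andbT; have := mem_last c s; rewrite inE => /orP[/eqP ->//|/tnthP[i ->]].
  by have := h3 i; rewrite in_itv => /andP[].
Qed.

Lemma simplex_cons r c e u (s : r.+1.-tuple R) : 0 <= c -> c <= e -> e <= T ->
  ([tuple of u :: s] \in simplex T c e) =
  (c <= u <= thead s) && (s \in simplex T c e) :> bool.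
Proof.
move=> c0 ce eT; case/tupleP: s => v s; rewrite theadE.
apply/idP/andP => [/set_mem|[/andP[cu uv] /set_mem]].
  move=> [/cubeP[h1 h2] /= /andP[cu /andP[uv h3]]]; split; first by rewrite cu uv.
  by apply/mem_set; split=> //=; rewrite h3 (le_trans cu uv).
move=> [h1 /= /andP[cv h2]]; apply/mem_set; split; last by rewrite /= cu uv.
apply/cubeP; split=> //; rewrite (le_trans c0 cu)/=; apply: (le_trans uv).
by move/cubeP: h1 => [/andP[]].
Qed.

(** The integral in the first coordinate [u], over [c <= u <= thead s], replaces
[F] by its primitive at [thead s]: the statement is the one that is preserved
when [r] decreases. *)
Lemma simplex_integral r (B : 'I_r.+1 -> R -> Omega -> R) F c e :
  (forall i, holder (B i)) -> holder F -> 0 <= c -> c <= e -> e <= T ->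
  exists J, Lall P J /\ iter_Lall P T B (fun s w => \1_(simplex T c e) s * F (thead s) w) J.
Proof.
move=> + + c0 ce eT; elim: r B F => [|r IH] B F HB HF.
  have [X [LX hX _]] := window_integral a_gt T0 HF (HB ord0) c0 ce eT.
  exists X; split=> //=; exists (fun=> X); split=> // s cs.
  have -> : X = (fun w => true%:R * X w) by apply/funext => w; rewrite mul1r.
  apply: RS_Lall_window hX => // u; rewrite in_itv/= => /andP[u0 uT]; apply/funext => w.
  rewrite mul1r /window theadE indicE; congr (_%:R * _); congr nat_of_bool.
  rewrite (tuple0 s); apply/idP/idP => [/set_mem[_] /=|h]; first by rewrite andbT.
  apply/mem_set; split; last by rewrite /= andbT.
  apply/cubeP; split; first by rewrite u0 uT.
  by case.
have [V [HV hV]] := primitive_exists a_gt T0 HF (HB ord0) c0 ce eT.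
have [J [LJ hJ]] := IH (fun i => B (lift ord0 i)) V (fun i => HB _) HV.
exists J; split=> //=.
exists (fun s w => \1_(simplex T c e) s * V (thead s) w); split=> // s cs.
rewrite indicE; case: (boolP (s \in simplex T c e)) => [sS|sS].
  have [_ _ h] := (simplexE s ce).1 (set_mem sS).
  have := h ord0; rewrite in_itv/= -/(thead s) => /hV hX.
  rewrite (_ : (fun w => _) = (fun w => true%:R * V (thead s) w))//.
  apply: RS_Lall_window hX => //; last exact: HV.1.
  move=> u _; apply/funext => w; rewrite theadE indicE simplex_cons// sS andbT mul1r.
  by [].
have := hV c; rewrite lexx ce => /(_ isT) hX.
rewrite (_ : (fun w => _) = (fun w => false%:R * V c w)); last first.
  by apply/funext => w; rewrite !mul0r.
apply: RS_Lall_window hX => //; last exact: HV.1.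
move=> u _; apply/funext => w; rewrite theadE indicE simplex_cons// (negbTE sS) andbF.
by rewrite !mul0r.
Qed.

(** A new piece meets the union of the previous ones in the degenerate piece
[G (t k) (t k)], so by linearity its indicator enters as
[1_(A `|` S) = 1_A + 1_S - 1_(A `&` S)]. *)
Lemma union_integral r (B : 'I_r -> R -> Omega -> R) (G : R -> R -> set (r.-tuple R))
    (t : nat -> R) n :
  (forall c e, 0 <= c -> c <= e -> e <= T ->
     exists J, Lall P J /\ iter_Lall P T B (fun s w => \1_(G c e) s) J) ->
  (forall c e c' e' s, c <= e -> e <= c' -> c' <= e' -> G c e s -> G c' e' s -> G c' c' s) ->
  (forall c e c' s, c <= e -> e <= c' -> G e e s -> G c e s /\ G e c' s) ->
  t 0%N = 0 -> t n = T -> (forall k, (k < n)%N -> t k < t k.+1) ->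
  exists J, Lall P J /\ iter_Lall P T B (fun s w => \1_(\bigcup_(k < n) G (t k) (t k.+1)) s) J.
Proof.
move=> exG G1 G2 t0 tn tS.
have tle i j : (i <= j)%N -> (j <= n)%N -> t i <= t j.
  elim: j => [|j IH]; first by rewrite leqn0 => /eqP ->.
  rewrite leq_eqVlt => /orP[/eqP ->//|]; rewrite ltnS => ij jn.
  exact: le_trans (IH ij (ltnW jn)) (ltW (tS _ jn)).
have t_ge0 i : (i <= n)%N -> 0 <= t i by move=> h; rewrite -t0 tle.
have t_leT i : (i <= n)%N -> t i <= T by move=> h; rewrite -tn tle.
suff H m : (0 < m)%N -> (m <= n)%N -> exists J, Lall P J /\
    iter_Lall P T B (fun s w => \1_(\bigcup_(k < m) G (t k) (t k.+1)) s) J.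
  case: n tn tS tle t_ge0 t_leT H => [tn|n tn tS tle t_ge0 t_leT H]; last exact: H.
  by move: T0; rewrite -tn t0 ltxx.
elim: m => // -[|m] IH _ mn.
  have [J [LJ hJ]] := exG (t 0%N) (t 1%N) (t_ge0 _ (leq0n _)) (tle _ _ (leq0n _) mn) (t_leT _ mn).
  exists J; split=> //; apply: iter_Lall_ext hJ => // s _; apply/funext => w.
  by rewrite bigcup_mkord big_ord1.
have [J1 [L1 h1]] := IH isT (ltnW mn).
have [J2 [L2 h2]] := exG (t m.+1) (t m.+2) (t_ge0 _ (ltnW mn)) (tle _ _ (leqnSn _) mn) (t_leT _ mn).
have [J3 [L3 h3]] := exG (t m.+1) (t m.+1) (t_ge0 _ (ltnW mn)) (lexx _) (t_leT _ (ltnW mn)).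
have h := iter_Lall_lin (- 1) (iter_Lall_lin 1 h1 h2) h3.
eexists; split; last first.
  apply: iter_Lall_ext h => // s _; apply/funext => w.
  rewrite [in RHS]bigcup_mkord big_ord_recr/= -(bigcup_mkord m.+1 (fun k => G (t k) (t k.+1))).
  set A := \bigcup_(k < _) _; set S := G _ (t m.+2).
  have -> : G (t m.+1) (t m.+1) = A `&` S.
    apply/seteqP; split=> x.
      move=> Gx; split; last by have [] := G2 (t m) (t m.+1) (t m.+2) x (tle _ _ (leqnSn _) (ltnW mn)) (tle _ _ (leqnSn _) mn) Gx.
      exists m => //=.
      by have [] := G2 (t m) (t m.+1) (t m.+2) x (tle _ _ (leqnSn _) (ltnW mn)) (tle _ _ (leqnSn _) mn) Gx.
    move=> [[k /= km Gk] Sx].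
    have kn : (k.+1 <= n)%N by apply: leq_trans (ltnW mn).
    exact: G1 (tle _ _ (leqnSn _) kn) (tle _ _ km (ltnW mn)) (tle _ _ (leqnSn _) mn) Gk Sx.
  rewrite !indicE in_setI in_setU.
  by case: (s \in A); case: (s \in S) => /=; ring.
by apply: LallD; [apply: LallD => //|]; apply: LallZ.
Qed.

Lemma cube_pieces r (s : r.-tuple R) :
  (forall c e c' e', c <= e -> e <= c' -> c' <= e' -> cube c e s -> cube c' e' s -> cube c' c' s) /\
  (forall c e c', c <= e -> e <= c' -> cube e e s -> cube c e s /\ cube e c' s).
Proof.
split=> [c e c' e' ce ec ce' h1 h2 i|c e c' ce ec h].
  have := h1 i; have := h2 i; rewrite !in_itv/= => /andP[-> _] /andP[_ h].
  by rewrite (le_trans h).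
split=> i; have := h i; rewrite !in_itv/= => /andP[h1 h2].
  by rewrite h2 (le_trans ce).
by rewrite h1 (le_trans h2).
Qed.

Variables (r n : nat) (B : 'I_r.+1 -> R -> Omega -> R) (t : nat -> R).
Hypothesis HB : forall i, holder (B i).
Hypothesis ht0 : t 0%N = 0.
Hypothesis htn : t n = T.
Hypothesis htS : forall k, (k < n)%N -> t k < t k.+1.

Lemma cubes_integral : exists J, Lall P J /\
  iter_Lall P T B (fun s w => \1_(\bigcup_(k < n) cube (t k) (t k.+1)) s) J.
Proof.
apply: union_integral => //.
- move=> c e c0 ce eT; have [J [LJ hJ]] := cube_integral HB c0 ce eT (Lall_cst P 1).
  exists J; split=> //; apply: iter_Lall_ext hJ => // s _; apply/funext => w.
  by rewrite mulr1.
- by move=> c e c' e' s; apply: (cube_pieces s).1.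
- by move=> c e c' s; apply: (cube_pieces s).2.
Qed.

Lemma simplices_integral : exists J, Lall P J /\
  iter_Lall P T B (fun s w => \1_(\bigcup_(k < n) simplex T (t k) (t k.+1)) s) J.
Proof.
apply: union_integral => //.
- move=> c e c0 ce eT.
  have [J [LJ hJ]] := simplex_integral HB (holder_cst (Lall_cst P 1)) c0 ce eT.
  exists J; split=> //; apply: iter_Lall_ext hJ => // s _; apply/funext => w.
  by rewrite mulr1.
- move=> c e c' e' s ce ec ce' /(simplexE _ ce)[h1 h2 h3] /(simplexE _ ce')[_ _ h4].
  apply/simplexE => //; split => //; exact: ((cube_pieces s).1 _ _ _ _ ce ec ce').
- move=> c e c' s ce ec /(simplexE _ (lexx e))[h1 h2 h3].
  have [h4 h5] := (cube_pieces s).2 _ _ _ ce ec h3.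
  by split; apply/simplexE.
Qed.

End Existence.

(** * Moments of centered normal variables *)

Section Normal.
Context (R : realType).
Local Notation mu := (@lebesgue_measure R).
Local Notation N01 := (@normal_prob R 0 1).
Implicit Types (m s y q : R).

Definition aff m s : measurableTypeR R -> measurableTypeR R := fun y => m + s * y.

Lemma measurable_aff m s : measurable_fun setT (aff m s).
Proof. by apply: measurable_funD => //; apply: measurable_funM. Qed.

HB.instance Definition _ m s := isMeasurableFun.Build _ _ _ _ (aff m s) (measurable_aff m s).

Lemma lebesgue_affine m s (s0 : 0 < s) (A : set R) : measurable A ->
  (mu A = s%:E * mu (aff m s @^-1` A))%E.
Proof.
move=> mA; pose k : {nonneg R} := NngNum (ltW s0).
apply: (@lebesgue_measure_unique R (mscale k (pushforward mu (aff m s)))) => //.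
move=> _ [[a b]] _ <-; change (mu `]a, b] = s%:E * mu (aff m s @^-1` `]a, b]))%E.
have -> : aff m s @^-1` `]a, b] = `](a - m) / s, (b - m) / s]%classic.
  apply/seteqP; split=> y /=; rewrite !in_itv/= /aff.
    by rewrite ltr_pdivrMr// ler_pdivlMr// ltrBlDl lerBrDl mulrC.
  by rewrite ltr_pdivrMr// ler_pdivlMr// ltrBlDl lerBrDl mulrC.
rewrite !lebesgue_measure_itv/= !lte_fin ltr_pM2r ?invr_gt0// ltrD2r.
case: ifPn => // _; last by rewrite mule0.
rewrite -!EFinB -EFinM; congr EFin; field; by rewrite gt_eqF.
Qed.

Lemma normal_pdf_aff m s y : 0 < s -> s * normal_pdf m s (m + s * y) = normal_pdf 0 1 y.
Proof.
move=> s0; rewrite !normal_pdfE ?gt_eqF// ?oner_neq0//.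
rewrite /normal_peak /normal_fun.
have -> : - (m + s * y - m) ^+ 2 / (s ^+ 2 *+ 2) = - (y - 0) ^+ 2 / (1 ^+ 2 *+ 2).
  by field; by rewrite gt_eqF.
rewrite mulrA; congr (_ * _).
rewrite -mulrnAr sqrtrM ?sqr_ge0// sqrtr_sqr gtr0_norm// invfM mulrA mulfV ?gt_eqF//.
by rewrite mul1r expr1n mul1r.
Qed.

Lemma normal_prob_aff m s (A : set R) : 0 < s -> measurable A ->
  normal_prob m s A = N01 (aff m s @^-1` A).
Proof.
move=> s0 mA; rewrite /normal_prob.
pose k : {nonneg R} := NngNum (ltW s0).
rewrite (@eq_measure_integral _ _ _ _ (mscale k (pushforward mu (aff m s)))); last first.
  by move=> B mB _; exact: lebesgue_affine.
rewrite ge0_integral_mscale//; first last.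
- by move=> x _; rewrite lee_fin normal_pdf_ge0.
- by apply/measurable_EFinP; apply: measurable_funTS; exact: measurable_normal_pdf.
rewrite ge0_integral_pushforward//=; first last.
- by move=> x _; rewrite lee_fin normal_pdf_ge0.
- by apply/measurable_EFinP; apply: measurable_funTS; exact: measurable_normal_pdf.
rewrite -ge0_integralZl//=.
- by apply: eq_integral => y _; rewrite -EFinM normal_pdf_aff.
- by rewrite -[X in measurable X]setTI; apply: measurable_aff.
- apply/measurable_EFinP; apply: measurable_funTS.
  by apply: (measurableT_comp (measurable_normal_pdf _ _)); apply: measurable_aff.
- by move=> y _; rewrite lee_fin normal_pdf_ge0.
- by rewrite lee_fin ltW.
Qed.

Lemma normal_prob_sym (A : set R) : measurable A -> N01 (-%R @^-1` A) = N01 A.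
Proof.
move=> mA.
have mo : measurable_fun setT (-%R : measurableTypeR R -> measurableTypeR R) by [].
rewrite /normal_prob.
rewrite [RHS](@eq_measure_integral _ _ _ _ (pushforward mu (-%R : _ -> measurableTypeR R))); last first.
  by move=> B mB _; exact/esym/lebesgue_measureN.
rewrite (ge0_integral_pushforward mo mu mA)/=; first last.
- by move=> x _; rewrite lee_fin normal_pdf_ge0.
- by apply/measurable_EFinP; apply: measurable_funTS; exact: measurable_normal_pdf.
apply: eq_integral => y _; congr EFin.
by rewrite !normal_pdfE ?oner_neq0// /normal_fun !subr0 sqrrN.
Qed.

(** Change of variables along a density requires an integrable function.  For
bounded functions this is known, and [normal_moment_fin] reaches the powers of
[|x|] by truncation. *)
Lemma integral_normal_bounded (f : R -> R) M : measurable_fun setT f ->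
  (forall x, 0 <= f x <= M) ->
  (\int[N01]_x (f x)%:E = \int[mu]_x (f x * normal_pdf 0 1 x)%:E)%E.
Proof.
move=> mf fM.
have intf : (N01 : {measure set (measurableTypeR R) -> \bar R}).-integrable setT (EFin \o f).
  apply/integrableP; split; first exact/measurable_EFinP.
  apply: (@le_lt_trans _ _ (\int[N01]_x (cst M%:E) x)%E).
    apply: ge0_le_integral => //.
    - by apply: measurableT_comp => //; exact/measurable_EFinP.
    - by move=> x _; rewrite lee_fin ger0_norm; case/andP: (fM x).
  by rewrite integral_cst//= /normal_prob integral_normal_pdf mule1 ltry.
rewrite -(Radon_Nikodym_change_of_variables (normal_prob_dominates 0 1))//=.
apply: ae_eq_integral => //.
- apply: emeasurable_funM => //; first exact/measurable_EFinP.
  apply: (measurable_int mu); apply: Radon_Nikodym_integrable; exact: normal_prob_dominates.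
- by apply/measurable_EFinP; apply: measurable_funM => //; exact: measurable_normal_pdf.
under [X in ae_eq _ _ _ X]eq_fun do rewrite EFinM.
apply: ae_eqe_mul2l => /=.
rewrite Radon_NikodymE//=; first exact: normal_prob_dominates.
move=> dom; case: cid => /= h [h1 h2 h3].
apply: integral_ae_eq => //=.
  by apply/measurable_EFinP; exact: measurable_normal_pdf.
by move=> E _ mE; rewrite -h3.
Qed.

Lemma abs_pow_exp_bound n (y : R) : (0 < n)%N ->
  `|y| ^+ (2 * n) <= (4 * n%:R) ^+ n * expR (y ^+ 2 / 4).
Proof.
move=> n0; have n0' : 0 < n%:R :> R by rewrite ltr0n.
pose x := y ^+ 2 / 4 / n%:R.
have x0 : 0 <= x by rewrite !divr_ge0// sqr_ge0.
have -> : y ^+ 2 / 4 = n%:R * x by rewrite /x; field; by rewrite gt_eqF.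
rewrite expRM_natl -exprMn exprM.
apply: lerXn2r; rewrite ?nnegrE ?exprn_ge0 ?mulr_ge0 ?expR_ge0 ?ler0n//.
have : x <= expR x by apply: le_trans (expR_ge1Dx x); rewrite lerDr.
rewrite real_normK ?num_real// => h.
have -> : y ^+ 2 = 4 * n%:R * x by rewrite /x; field; by rewrite gt_eqF.
by rewrite ler_wpM2l ?mulr_ge0 ?ler0n.
Qed.

Lemma abs_powR_bound q : 0 < q -> exists K : R, 0 <= K /\
  forall y, `|y| `^ q <= K * expR (y ^+ 2 / 4).
Proof.
move=> q0; pose n := (Num.truncn q).+1.
have qn : q <= (2 * n)%:R.
  apply: ltW; apply: lt_le_trans (truncnS_gt q) _.
  by rewrite ler_nat mul2n -addnn leq_addl.
exists (1 + (4 * n%:R) ^+ n); split; first by rewrite addr_ge0// exprn_ge0// mulr_ge0.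
move=> y; have [y1|y1] := leP `|y| 1.
  apply: (@le_trans _ _ 1).
    have <- : (1 : R) `^ q = 1 by rewrite powR1.
    apply: ge0_ler_powR; rewrite ?nnegrE//; exact: ltW.
  rewrite mulrDl mul1r -[leLHS]addr0; apply: lerD.
    by apply: le_trans (expR_ge1Dx _); rewrite lerDl divr_ge0// sqr_ge0.
  by rewrite mulr_ge0 ?expR_ge0// exprn_ge0// mulr_ge0.
apply: (@le_trans _ _ (`|y| `^ (2 * n)%:R)); first by apply: ler_powR => //; exact: ltW.
rewrite powR_mulrn// mulrDl mul1r; apply: le_trans (abs_pow_exp_bound y (ltn0Sn _)) _.
by rewrite lerDr expR_ge0.
Qed.

(** The factor [expR (y ^+ 2 / 4)] turns the exponent [- y^2 / 2] into
[- y^2 / 4], the exponent of a normal density of variance 2. *)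
Lemma normal_pdf_exp y : normal_pdf 0 1 y * expR (y ^+ 2 / 4) =
  Num.sqrt 2 * normal_pdf 0 (Num.sqrt 2) y.
Proof.
have s2 : 0 < Num.sqrt 2 :> R by rewrite sqrtr_gt0.
rewrite !normal_pdfE ?gt_eqF// ?oner_neq0//.
rewrite /normal_peak /normal_fun -mulrA -expRD mulrA sqr_sqrtr//; congr (_ * _).
  rewrite expr1n mul1r -mulrnAr sqrtrM// invfM mulrA mulfV ?gt_eqF//.
  by rewrite mul1r.
by congr expR; rewrite !subr0 expr1n; field.
Qed.

(** [|x|^q] is at most a multiple of [expR (x ^+ 2 / 4)], and this times the
density is a multiple of another normal density. *)
Lemma normal_moment_fin q : 0 < q -> (\int[N01]_x (`|x| `^ q)%:E < +oo)%E.
Proof.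
move=> q0; have [K [K0 hK]] := abs_powR_bound q0.
pose f n (x : R) := Num.min (`|x| `^ q) n%:R.
have mp : measurable_fun setT (fun x : R => `|x| `^ q).
  apply: (@measurableT_comp _ _ _ _ _ _ (fun x : R => x `^ q)%R) => //.
have mf n : measurable_fun setT (f n) by apply: measurable_minr.
have f0 n x : 0 <= f n x by rewrite /f le_min powR_ge0 ler0n.
pose C : R := K * Num.sqrt 2.
have fC n : (\int[N01]_x (f n x)%:E <= C%:E)%E.
  rewrite (@integral_normal_bounded _ n%:R)//; last first.
    by move=> x; rewrite f0 /f ge_min lexx orbT.
  have C0 : 0 <= C by rewrite mulr_ge0.
  apply: (@le_trans _ _ (\int[mu]_x (C%:E * (normal_pdf 0 (Num.sqrt 2) x)%:E))%E).
    apply: ge0_le_integral => //.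
    - by move=> x _; rewrite lee_fin mulr_ge0 ?normal_pdf_ge0.
    - by apply/measurable_EFinP; apply: measurable_funM; [exact: mf|exact: measurable_normal_pdf].
    - by apply: measurable_funeM; apply/measurable_EFinP; exact: measurable_normal_pdf.
    move=> x _; rewrite -EFinM lee_fin /C -mulrA -normal_pdf_exp.
    rewrite mulrCA [leRHS]mulrC [leRHS]mulrC; rewrite mulrC.
    apply: ler_wpM2r; first exact: normal_pdf_ge0.
    by apply: le_trans (hK x); rewrite /f ge_min lexx.
  rewrite ge0_integralZl//.
  - by rewrite integral_normal_pdf mule1.
  - by apply/measurable_EFinP; exact: measurable_normal_pdf.
  - by move=> x _; rewrite lee_fin normal_pdf_ge0.
apply: (@le_lt_trans _ _ C%:E); last by rewrite ltry.
have -> : (\int[N01]_x (`|x| `^ q)%:E = \int[N01]_x limn (fun n => (f n x)%:E))%E.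
  apply: eq_integral => x _; apply/esym/cvg_lim => //; apply: cvg_EFin; first exact: nearW.
  apply/cvgrPdist_le => e e0; exists (Num.truncn (`|x| `^ q)).+1 => // n /= hn.
  rewrite /f min_l ?subrr ?normr0 ?(ltW e0)//.
  apply: ltW; apply: lt_le_trans (truncnS_gt _) _; by rewrite ler_nat.
rewrite monotone_convergence//.
- apply: lime_le; last by apply: nearW.
  apply: ereal_nondecreasing_is_cvgn => i j ij; apply: ge0_le_integral => //.
  + by move=> x _; rewrite lee_fin.
  + by apply/measurable_EFinP; exact: mf.
  + by apply/measurable_EFinP; exact: mf.
  + by move=> x _; rewrite lee_fin /f le_min ge_min lexx/= ge_min ler_nat ij orbT.
- by move=> n; apply/measurable_EFinP; exact: mf.
- by move=> n x _; rewrite lee_fin.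
- by move=> x _ i j ij; rewrite lee_fin /f le_min ge_min lexx/= ge_min ler_nat ij orbT.
Qed.

Definition std_normal : probability (measurableTypeR R) R := N01.

Definition abs_moment q : R := fine (\int[std_normal]_x (`|x| `^ q)%:E).

Lemma Lnorm_le_id q : 0 < q -> Lnorm_le std_normal q (fun y => y) (abs_moment q `^ q^-1).
Proof.
move=> q0; have I0 : (0 <= \int[std_normal]_x (`|x| `^ q)%:E)%E.
  by apply: integral_ge0 => x _; rewrite lee_fin powR_ge0.
have m0 : 0 <= abs_moment q by apply: fine_ge0.
apply/Lnorm_leP => //; first exact: powR_ge0.
rewrite -powRrM mulVf ?gt_eqF// powRr1// /abs_moment fineK//.
by rewrite ge0_fin_numE//; exact: normal_moment_fin.
Qed.

Lemma Lall_id : Lall std_normal (fun y => y).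
Proof. by move=> q q1; exists (abs_moment q `^ q^-1); apply: Lnorm_le_id; lra. Qed.

Lemma Lall_aff m s : Lall std_normal (aff m s).
Proof. by apply: LallD; [exact: Lall_cst|apply: LallM; [exact: Lall_cst|exact: Lall_id]]. Qed.

Lemma LallX d (T : measurableType d) (P : probability T R) (X : T -> R) k :
  Lall P X -> Lall P (fun w => X w ^+ k).
Proof.
move=> LX; elim: k => [|k IH]; first exact: Lall_cst.
rewrite (_ : (fun w => _) = (fun w => X w * X w ^+ k)); first exact: LallM.
by apply/funext => w; rewrite exprS.
Qed.

Definition moment k : R := Ex std_normal (fun y => y ^+ k).

Lemma Lall_int d (T : measurableType d) (P : probability T R) (X : T -> R) :
  Lall P X -> P.-integrable setT (EFin \o X).
Proof. by move=> /(Lall_Lfun (lexx 1))/Lfun1_integrable. Qed.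

Lemma moment_odd k : odd k -> moment k = 0.
Proof.
move=> ko; suff h : moment k = - moment k by lra.
have LX := LallX k Lall_id.
have mo : measurable_fun setT (-%R : measurableTypeR R -> measurableTypeR R) by [].
rewrite {1}/moment /Ex unlock.
rewrite (@eq_measure_integral _ _ _ _ (pushforward std_normal (-%R : _ -> measurableTypeR R))); last first.
  by move=> A mA _; apply/esym/normal_prob_sym.
have EN : (fun y : measurableTypeR R => (- y) ^+ k) = (fun y => -1 * y ^+ k).
  by apply/funext => y; rewrite exprNn -signr_odd ko expr1.
have LN : Lall std_normal (fun y : measurableTypeR R => (- y) ^+ k).
  by rewrite EN; apply: LallM => //; exact: Lall_cst.
rewrite integral_pushforward//=; first last.
- exact: (Lall_int LN).
- by apply/measurable_EFinP; exact: (Lall_meas LX).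
have -> : - moment k = Ex std_normal (fun y => (- y) ^+ k).
  by rewrite EN ExZ// mulN1r.
by rewrite /Ex unlock.
Qed.

Lemma moment_even_ge0 k : ~~ odd k -> 0 <= moment k.
Proof.
move=> ke; rewrite /moment /Ex; apply: fine_ge0; apply: expectation_ge0 => y.
by rewrite exprn_even_ge0.
Qed.

Lemma Ex_eq0_ae d (T : measurableType d) (P : probability T R) (X : T -> R) :
  Lall P X -> Ex P (fun w => X w ^+ 2) = 0 -> {ae P, forall w, X w = 0}.
Proof.
move=> LX E0; have L2 := LallX 2 LX.
have : ('E_P[(fun w => X w ^+ 2)%R] = 0)%E by rewrite Lall_fin// E0.
rewrite unlock => I0.
have mE : measurable_fun setT (EFin \o (fun w => X w ^+ 2)).
  by apply/measurable_EFinP; exact: (Lall_meas L2).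
have : (\int[P]_w `|(EFin \o (fun w => (X w ^+ 2)%R)) w| = 0)%E.
  by rewrite -I0; apply: eq_integral => w _; rewrite /= ger0_norm ?sqr_ge0.
move/(ae_eq_integral_abs P measurableT mE); apply: filterS => w /= /(_ I)[].
by move/eqP; rewrite sqrf_eq0 => /eqP.
Qed.

(** Otherwise the standard normal law would be carried by the null set [{0}]. *)
Lemma moment2_gt0 : 0 < moment 2.
Proof.
rewrite lt_neqAle moment_even_ge0// andbT eq_sym; apply/eqP => h.
have [N [mN N0 sN]] := Ex_eq0_ae Lall_id h.
have m0 : mu [set 0 : R] = 0%E by rewrite lebesgue_measure_set1.
have g0 : std_normal [set 0] = 0%E.
  by apply: (null_content_dominatesP _ _).1 (normal_prob_dominates 0 1) _ _ m0.
have : std_normal setT = 0%E.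
  apply/eqP; rewrite eq_le measure_ge0 andbT -[leRHS](adde0 0%E) -{1}N0 -g0.
  apply: (@le_trans _ _ (std_normal (N `|` [set 0]))); last exact: measureU2.
  apply: le_measure; rewrite ?inE//; first exact: measurableU.
  by move=> y _; have [->|/eqP y0] := eqVneq y 0; [right|left; apply: sN].
by rewrite probability_setT => -[] /eqP; rewrite oner_eq0.
Qed.

End Normal.

Section NormalRV.
Context d (Omega : measurableType d) (R : realType) (P : probability Omega R).
Implicit Types X : Omega -> R.

Section Transfer.
Variables (X : Omega -> R) (m s : R).
Hypothesis mX : measurable_fun setT X.
Hypothesis s0 : 0 < s.
Hypothesis lawX : forall U : set R, measurable U -> P (X @^-1` U) = normal_prob m s U.

Let lawX' (U : set (measurableTypeR R)) : measurable U ->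
  pushforward P (X : _ -> measurableTypeR R) U = pushforward (std_normal R) (aff m s) U.
Proof. by move=> mU; exact: (etrans (lawX mU) (normal_prob_aff m s0 mU)). Qed.

Lemma transfer_ge0 (f : R -> \bar R) : measurable_fun setT f -> (forall x, 0 <= f x)%E ->
  (\int[P]_w f (X w) = \int[std_normal R]_y f (aff m s y))%E.
Proof.
move=> mf f0.
have := @ge0_integral_pushforward _ _ _ _ R (X : _ -> measurableTypeR R) mX P setT f measurableT mf (fun x _ => f0 x).
rewrite preimage_setT => <-.
have := @ge0_integral_pushforward _ _ _ _ R _ (measurable_aff m s) (std_normal R) setT f measurableT mf (fun x _ => f0 x).
rewrite preimage_setT => <-.
by apply: eq_measure_integral => U mU _; apply: lawX'.
Qed.

Lemma transfer_Lnorm_le (f : R -> R) q C : 0 < q -> 0 <= C -> measurable_fun setT f ->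
  Lnorm_le (std_normal R) q (fun y => f (aff m s y)) C -> Lnorm_le P q (fun w => f (X w)) C.
Proof.
move=> q0 C0 mf b; have mfX := measurableT_comp mf mX.
apply/Lnorm_leP => //; have /Lnorm_leP-/(_ q0 C0 b.1) := b.
apply: le_trans; rewrite (@transfer_ge0 (fun x => (`|f x| `^ q)%:E))//.
  by apply/measurable_EFinP; exact: measurable_abspow.
Qed.

Lemma transfer_Lall (f : R -> R) : measurable_fun setT f ->
  Lall (std_normal R) (fun y => f (aff m s y)) -> Lall P (fun w => f (X w)).
Proof.
move=> mf L q q1; have [C hC] := L q q1; exists C.
by apply: transfer_Lnorm_le => //; [lra|exact: Lnorm_le_ge0 hC].
Qed.

Lemma transfer_Ex (f : R -> R) : measurable_fun setT f ->
  Lall (std_normal R) (fun y => f (aff m s y)) ->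
  Ex P (fun w => f (X w)) = Ex (std_normal R) (fun y => f (aff m s y)).
Proof.
move=> mf L; have L' := transfer_Lall mf L.
rewrite /Ex unlock; congr fine.
have mEf : measurable_fun setT (EFin \o f) by exact/measurable_EFinP.
have := @integral_pushforward _ _ _ _ R (X : _ -> measurableTypeR R) mX P setT (EFin \o f) mEf.
rewrite preimage_setT => /(_ (Lall_int L') measurableT) /= <-.
have := @integral_pushforward _ _ _ _ R _ (measurable_aff m s) (std_normal R) setT (EFin \o f) mEf.
rewrite preimage_setT => /(_ (Lall_int L) measurableT) /= <-.
by apply: eq_measure_integral => U mU _; apply: lawX'.
Qed.

End Transfer.

(** The moments of the law N(0, s^2), where [s = 0] is the degenerate law at 0.
Isserlis' formula and the Hoelder estimates see the law through them only. *)
Definition centered_normal X s := [/\ 0 <= s,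
  forall q, 0 < q -> Lnorm_le P q X (abs_moment q `^ q^-1 * s) &
  forall k, Ex P (fun w => X w ^+ k) = moment R k * s ^+ k].

Lemma centered_gaussian X : gaussian_rv P X -> ('E_P[X] = 0)%E ->
  exists s, centered_normal X s.
Proof.
move=> [mX [[m Xm]|[m [s [s0 law]]]]] EX0.
  have m0 : m = 0.
    apply/esym; have : (0%:E = m%:E)%E; last by case.
    rewrite -[LHS]EX0 -[RHS](expectation_cst P m) unlock; apply: ae_eq_integral => //.
    - exact/measurable_EFinP.
    - by apply/measurable_EFinP; exact: measurable_cst.
    - by apply: filterS Xm => w /= -> _.
  rewrite m0 in Xm.
  have b0 q : 0 < q -> Lnorm_le P q X 0.
    move=> q0; apply: (Lnorm_le_ae mX) (Lnorm_le0 P q0 (lexx 0)).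
    by apply: filterS Xm => w ->.
  have LX : Lall P X by move=> q q1; exists 0; apply: b0; lra.
  exists 0; split=> // [q q0|k]; first by rewrite mulr0; apply: b0.
  case: k => [|k].
    rewrite /moment; under eq_fun do rewrite expr0.
    by under [in RHS]eq_fun do rewrite expr0; rewrite !Ex_cst expr0 mulr1.
  rewrite expr0n/= mulr0 -(Ex_cst P 0); apply: Ex_ae; [exact: LallX|exact: Lall_cst|].
  by apply: filterS Xm => w ->; rewrite expr0n.
have mid : measurable_fun setT (fun x : R => x) by [].
have Em := transfer_Ex mX s0 law mid (Lall_aff m s).
have m0 : m = 0.
  have : Ex P X = m.
    rewrite Em /aff ExD; [|exact: Lall_cst|by apply: LallM; [exact: Lall_cst|exact: Lall_id]].
    rewrite Ex_cst ExZ; last exact: Lall_id.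
    have -> : Ex (std_normal R) (fun y => y) = moment R 1.
      by rewrite /moment; congr Ex; apply/funext => y; rewrite expr1.
    by rewrite moment_odd// mulr0 addr0.
  by rewrite /Ex EX0 => <-.
subst m.
have affE y : aff 0 s y = s * y by rewrite /aff add0r.
exists s; split=> [|q q0|k]; first exact: ltW.
  apply: (transfer_Lnorm_le mX s0 law (f := fun x => x)) => //.
    by rewrite mulr_ge0 ?powR_ge0// ltW.
  have /Lnorm_leP : Lnorm_le (std_normal R) q (fun y => y) (abs_moment q `^ q^-1) by apply: Lnorm_le_id.
  move=> /(_ q0 (powR_ge0 _ _) mid) h.
  apply/Lnorm_leP => //; [by rewrite mulr_ge0 ?powR_ge0// ltW|exact: measurable_aff|].
  under eq_integral do rewrite affE normrM powRM// EFinM.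
  rewrite ge0_integralZl//=; first last.
  - by apply/measurable_EFinP; exact: measurable_abspow.
  rewrite powRM ?powR_ge0 ?(ltW s0)// muleC EFinM gtr0_norm//.
  by rewrite lee_wpmul2r// lee_fin powR_ge0.
have mp : measurable_fun setT (fun x : R => x ^+ k) by exact: exprn_measurable.
rewrite (transfer_Ex mX s0 law mp); last exact/LallX/Lall_aff.
rewrite mulrC -ExZ; last exact/LallX/Lall_id.
by congr Ex; apply/funext => y; rewrite affE exprMn.
Qed.

End NormalRV.

(** * Isserlis' formula and nonnegative products *)

Local Close Scope classical_set_scope.

Section Isserlis.
Variable R : realFieldType.

(** Expansion of the product over [i] of [1 - (i \notin U)%:R]. *)
Lemma alternating_sum (I : finType) (U : {set I}) :
  \sum_(S : {set I}) (-1) ^+ #|~: S| * (U \subset S)%:R = (U == [set: I])%:R :> R.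
Proof.
have := @bigA_distr R 0 1 *%R +%R I (fun=> 1) (fun i => - (i \notin U)%:R).
have -> : \prod_i (1 + - (i \notin U)%:R) = (U == [set: I])%:R :> R.
  have [->|UT] := eqVneq U [set: I].
    by rewrite big1// => i _; rewrite inE subr0.
  have [i iU] : exists i, i \notin U.
    apply/existsP; move: UT; apply: contraNT; rewrite negb_exists => /forallP h.
    by apply/eqP/setP => i; rewrite inE; have := h i; rewrite negbK.
  by rewrite (bigD1 i)//= iU subrr mul0r.
move=> ->; apply: eq_bigr => S _.
rewrite (bigID (mem S))/= [X in _ = X * _]big1 ?mul1r; last by move=> i ->.
rewrite (eq_bigr (fun i => -1 * (i \notin U)%:R)); last first.
  by move=> i /negbTE ->; rewrite mulN1r.
rewrite big_split/= prodr_const; congr (_ ^+ _ * _).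
  by apply: eq_card => i; rewrite !inE.
have [/fintype.subsetP US|/fintype.subsetPn[i iU iS]] := boolP (U \subset S).
  rewrite big1// => i iS; case: (boolP (i \in U)) => // /US; rewrite (negbTE iS).
  by [].
by rewrite (bigD1 i)//= iU mul0r.
Qed.

(** After the power is expanded, a choice [f] of [n] terms is counted with the
alternating sum over all [S] that contain [p (f k)] for every [k]; by
[alternating_sum] it vanishes unless these sets cover [I]. *)
Lemma alternating_power (I J : finType) (p : J -> {set I}) (x : J -> R) n :
  \sum_(S : {set I}) (-1) ^+ #|~: S| * (\sum_(j | p j \subset S) x j) ^+ n =
  \sum_(f : {ffun 'I_n -> J} | \bigcup_k p (f k) == [set: I]) \prod_k x (f k).
Proof.
have powE (S : {set I}) : (\sum_(j | p j \subset S) x j) ^+ n =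
    \sum_(f : {ffun 'I_n -> J}) (\bigcup_k p (f k) \subset S)%:R * \prod_k x (f k).
  rewrite -[n in LHS]card_ord -prodr_const.
  under eq_bigr do rewrite big_mkcond/=.
  rewrite bigA_distr_bigA/=; apply: eq_bigr => f _.
  have -> : (\bigcup_k p (f k) \subset S) = [forall k, p (f k) \subset S].
    by apply/bigcupsP/forallP => [h k|h k _]; apply: h.
  have [/forallP h|/forallPn[k hk]] := boolP [forall k, p (f k) \subset S].
    by rewrite mul1r; apply: eq_bigr => k _; rewrite h.
  by rewrite mul0r (bigD1 k)//= (negbTE hk) mul0r.
under eq_bigr do rewrite powE mulr_sumr.
rewrite exchange_big/= [RHS]big_mkcond/=; apply: eq_bigr => f _.
under eq_bigr do rewrite mulrA.
rewrite -mulr_suml alternating_sum.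
by case: ifP => _; rewrite ?mul1r ?mul0r.
Qed.

(** Equal to [#|I|`!]. *)
Definition nsurj (I : finType) : nat :=
  #|[set f : {ffun 'I_#|I| -> I} | \bigcup_k [set f k] == [set: I]]|.

Lemma nsurj_gt0 I : (0 < nsurj I)%N.
Proof.
apply/card_gt0P; exists [ffun k => enum_val k]; rewrite inE.
apply/eqP/setP => i; rewrite inE; apply/bigcupP; exists (enum_rank i) => //.
by rewrite inE ffunE enum_rankK.
Qed.

(** [#|I|] singletons cover [I] only if they are listed without repetition, and
then each list contributes the full product. *)
Lemma polarization (I : finType) (x : I -> R) :
  \sum_(S : {set I}) (-1) ^+ #|~: S| * (\sum_(i in S) x i) ^+ #|I| =
  (nsurj I)%:R * \prod_i x i.
Proof.
have := alternating_power (fun i : I => [set i]) x #|I|.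
have hE (S : {set I}) : \sum_(j | [set j] \subset S) x j = \sum_(j in S) x j.
  by apply: eq_bigl => j; rewrite finset.sub1set.
under [LHS]eq_bigr do rewrite hE.
move=> ->; rewrite mulr_natl -sumr_const.
rewrite [RHS](eq_bigl (fun f : {ffun 'I_#|I| -> I} => \bigcup_k [set f k] == [set: I])); last first.
  by move=> f; rewrite inE.
apply: eq_bigr => f /eqP hf.
have finj : injective f.
  apply/injectiveP; rewrite /injectiveb /dinjectiveb.
  apply/card_uniqP; rewrite size_map -cardE card_ord.
  apply/esym; rewrite -[LHS]cardsT -hf; apply: eq_card => i.
  apply/bigcupP/fintype.imageP => [[k _]|[k _ ->]]; first by rewrite inE => /eqP ->; exists k.
  by exists k; rewrite ?inE.
have cI : #|'I_#|I| | = #|I| by rewrite card_ord.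
have fbij : bijective f by apply: inj_card_bij => //; rewrite card_ord.
by rewrite [RHS](reindex f)//=; exact: onW_bij.
Qed.

End Isserlis.

Section GaussProduct.
Context d (Omega : measurableType d) (R : realType) (P : probability Omega R).

(** Isserlis' formula up to a positive factor.  [polarization] writes the product
as an alternating sum of [n]-th powers of the sums [X_S] of the [X i] over [S].
The expectation of such a power is a universal multiple of the [n/2]-th power
of the variance of [X_S], and this variance is the sum of the covariances of
the pairs inside [S].  So [alternating_power], now with pairs in place of
singletons, leaves the products of [n/2] covariances whose pairs cover [I]. *)
Lemma gauss_product_ge0 (I : finType) (X : I -> Omega -> R) :
  (forall S : {set I}, exists s, centered_normal P (fun w => \sum_(i in S) X i w) s) ->
  (forall i, Lall P (X i)) ->
  (forall i j, 0 <= Ex P (fun w => X i w * X j w)) ->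
  0 <= Ex P (fun w => \prod_i X i w).
Proof.
move=> gX LX cX.
have /choice[sg hs] := gX.
have LS (S : {set I}) : Lall P (fun w => \sum_(i in S) X i w).
  rewrite (_ : (fun w => _) = (fun w => \sum_(i <- enum S) X i w)); first exact: Lall_sum.
  by apply/funext => w; rewrite big_enum.
have N0 : 0 < (nsurj I)%:R :> R by rewrite ltr0n nsurj_gt0.
have LP : Lall P (fun w => \prod_i X i w) by apply: Lall_prod.
rewrite -(pmulr_rge0 _ N0) -ExZ//.
rewrite (_ : (fun w => _) = (fun w => \sum_(S : {set I}) (-1) ^+ #|~: S| *
    (\sum_(i in S) X i w) ^+ #|I|)); last by apply/funext => w; rewrite polarization.
have LSX S := LallX #|I| (LS S).
rewrite Ex_sum; last by move=> S; apply: LallZ.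
rewrite (eq_bigr (fun S : {set I} => (-1) ^+ #|~: S| * (moment R #|I| * sg S ^+ #|I|))); last first.
  by move=> S _; rewrite ExZ//; congr (_ * _); have [_ _ ->] := hs S.
have [Io|Ie] := boolP (odd #|I|).
  by rewrite big1// => S _; rewrite moment_odd// mul0r mulr0.
have m2 := moment2_gt0 R.
pose C (p : I * I) := Ex P (fun w => X p.1 w * X p.2 w).
have varE S : moment R 2 * sg S ^+ 2 = \sum_(p : I * I | [set p.1; p.2] \subset S) C p.
  have [_ _ <-] := hs S.
  rewrite (_ : (fun w => _) = (fun w => \sum_(p <- enum [pred p : I * I | (p.1 \in S) && (p.2 \in S)]) X p.1 w * X p.2 w)).
    rewrite Ex_sum; last by move=> p; apply: LallM.
    rewrite big_enum/=; apply: eq_bigl => p.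
    by rewrite inE finset.subUset !finset.sub1set.
  apply/funext => w; rewrite big_enum/= expr2 mulr_suml.
  rewrite (eq_bigr (fun i => \sum_(j in S) X i w * X j w)); last by move=> i _; rewrite mulr_sumr.
  by rewrite pair_big.
pose h := #|I|./2.
have cE : #|I| = (2 * h)%N by rewrite mul2n -[LHS]odd_double_half (negbTE Ie).
have m2h : 0 < moment R 2 ^+ h by rewrite exprn_gt0.
rewrite (eq_bigr (fun S : {set I} => (moment R #|I| / moment R 2 ^+ h) *
   ((-1) ^+ #|~: S| * (\sum_(p : I * I | [set p.1; p.2] \subset S) C p) ^+ h))); last first.
  move=> S _; rewrite -varE exprMn -exprM -cE.
  by field; rewrite expf_neq0// gt_eqF.
rewrite -mulr_sumr alternating_power; apply: mulr_ge0.
  by rewrite divr_ge0 ?moment_even_ge0// ltW.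
by apply: sumr_ge0 => f _; apply: prodr_ge0 => k _; apply: cX.
Qed.

End GaussProduct.

Local Open Scope classical_set_scope.
Local Open Scope ring_scope.

(** * The integrators *)

Section Convexity.
Variable R : realType.

Lemma abs_powR_convex (p t x y : R) : 1 <= p -> 0 <= t <= 1 ->
  `|t * x + (1 - t) * y| `^ p <= t * `|x| `^ p + (1 - t) * `|y| `^ p.
Proof.
move=> p1 /andP[t0 t1].
have t1' : 0 <= 1 - t by rewrite subr_ge0.
have h : (t * `|x| + (1 - t) * `|y|) `^ p <= t * `|x| `^ p + (1 - t) * `|y| `^ p.
  have := @convex_powR R p p1 (Itv01 t0 t1) `|x| `|y|.
  rewrite !inE/= !in_itv/= !normr_ge0 => /(_ isT isT).
  by move=> h; rewrite !convRE/= /unstable.onem in h.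
apply: le_trans h; apply: ge0_ler_powR; rewrite ?nnegrE ?addr_ge0 ?mulr_ge0//.
  by lra.
apply: le_trans (ler_normD _ _) _.
by rewrite !normrM (ger0_norm t0) (ger0_norm t1').
Qed.

(** [y1] and [y2] are convex combinations of [x1] and [x2] with exchanged
weights. *)
Lemma four_point_convex (p x1 x2 y1 y2 : R) : 1 <= p ->
  x2 <= y1 <= x1 -> y1 + y2 = x1 + x2 ->
  `|y1| `^ p + `|y2| `^ p <= `|x1| `^ p + `|x2| `^ p.
Proof.
move=> p1 /andP[h1 h2] e.
have [x12|x12] := eqVneq x1 x2.
  have y1E : y1 = x1 by apply/eqP; rewrite eq_le h2 x12 h1.
  have -> : y2 = x2 by lra.
  by rewrite y1E.
have d0 : 0 < x1 - x2 by rewrite subr_gt0 lt_neqAle eq_sym x12 (le_trans h1).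
pose t := (y1 - x2) / (x1 - x2).
have t01 : 0 <= t <= 1.
  by rewrite divr_ge0 ?subr_ge0// ?(le_trans h1)//= ler_pdivrMr// mul1r lerD2r.
have t01' : 0 <= 1 - t <= 1 by move: t01 => /andP[? ?]; apply/andP; split; lra.
have d0' : x1 - x2 != 0 by rewrite gt_eqF.
have y1E : y1 = t * x1 + (1 - t) * x2 by rewrite /t; field.
have y2E : y2 = (1 - t) * x1 + (1 - (1 - t)) * x2.
  have -> : y2 = x1 + x2 - y1 by lra.
  by rewrite y1E; ring.
have b1 := abs_powR_convex x1 x2 p1 t01.
have b2 := abs_powR_convex x1 x2 p1 t01'.
rewrite -y1E in b1; rewrite -y2E in b2.
apply: le_trans (lerD b1 b2) _.
by rewrite le_eqVlt; apply/orP; left; apply/eqP; ring.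
Qed.

End Convexity.

Section FBm.
Context d (Omega : measurableType d) (R : realType) (P : probability Omega R).
Variables (T H : R) (X : R -> Omega -> R).
Hypothesis T0 : 0 < T.
Hypothesis H_gt : 1 / 2 < H.
Hypothesis fX : is_fBm P T H X.

Let EX t : t \in `[0, T] -> ('E_P[X t] = 0)%E. Proof. by case: fX => _ _ h _; apply: h. Qed.

Lemma centered_normal_Lall Y s : centered_normal P Y s -> Lall P Y.
Proof. by move=> [_ h _] q q1; exists (abs_moment q `^ q^-1 * s); apply: h; lra. Qed.

Lemma fBm_Lall t : t \in `[0, T] -> Lall P (X t).
Proof.
move=> tT; have [_ gX _ _] := fX.
have := gX 1%N (fun=> t) (fun=> 1) (fun=> tT).
have -> : (fun w => \sum_(i < 1) 1 * X t w) = X t.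
  by apply/funext => w; rewrite big_ord1 mul1r.
by move=> /centered_gaussian/(_ (EX tT))[s]; exact: centered_normal_Lall.
Qed.

Lemma fBm_comb n (u v c : 'I_n -> R) : (forall i, u i \in `[0, T]) -> (forall i, v i \in `[0, T]) ->
  exists s, centered_normal P (fun w => \sum_i c i * (X (v i) w - X (u i) w)) s.
Proof.
move=> uT vT; have [_ gX _ _] := fX.
pose t k := match fintype.split k with inl i => v i | inr i => u i end.
pose c' k := match fintype.split k with inl i => c i | inr i => - c i end.
have tT k : t k \in `[0, T] by rewrite /t; case: (fintype.split k).
have := gX (n + n)%N t c' tT.
have -> : (fun w => \sum_(i < n + n) c' i * X (t i) w) =
          (fun w => \sum_i c i * (X (v i) w - X (u i) w)).
  apply/funext => w; rewrite big_split_ord/= -big_split/=; apply: eq_bigr => i _.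
  rewrite /c' /t -/(unsplit (inl i)) -/(unsplit (inr i)) !unsplitK; ring.
move=> /centered_gaussian; apply.
have L i : Lall P (fun w => c i * (X (v i) w - X (u i) w)).
  by apply/LallZ/LallB; apply: fBm_Lall.
have E i : Ex P (fun w => c i * (X (v i) w - X (u i) w)) = 0.
  rewrite ExZ; last by apply: LallB; apply: fBm_Lall.
  by rewrite ExB; [rewrite /Ex !EX// subrr mulr0|exact: fBm_Lall|exact: fBm_Lall].
rewrite Lall_fin; last exact: Lall_sum.
by rewrite Ex_sum// big1.
Qed.

Lemma fBm_incr u v : u \in `[0, T] -> v \in `[0, T] ->
  exists s, centered_normal P (fun w => X v w - X u w) s.
Proof.
move=> uT vT; have [s hs] := @fBm_comb 1 (fun=> u) (fun=> v) (fun=> 1) (fun=> uT) (fun=> vT).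
exists s; move: hs; congr centered_normal; apply/funext => w.
by rewrite big_ord1 mul1r.
Qed.

Let r (s t : R) := 2^-1 * (t `^ (2 * H) + s `^ (2 * H) - `|t - s| `^ (2 * H)).

Lemma fBm_cov s t : s \in `[0, T] -> t \in `[0, T] -> Ex P (fun w => X s w * X t w) = r s t.
Proof.
move=> sT tT; have [_ _ _ /(_ s t sT tT)] := fX.
rewrite [X in X = _](_ : _ = (Ex P (fun w => X s w * X t w))%:E); first by case.
rewrite unlock !EX//= -Lall_fin; last by apply: LallM; apply: fBm_Lall.
by congr expectation; apply/funext => w /=; rewrite !fctE /= !subr0.
Qed.

Lemma fBm_incr_cov u v u' v' : u \in `[0, T] -> v \in `[0, T] ->
  u' \in `[0, T] -> v' \in `[0, T] ->
  Ex P (fun w => (X v w - X u w) * (X v' w - X u' w)) =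
  2^-1 * (`|v - u'| `^ (2 * H) + `|u - v'| `^ (2 * H)
        - (`|v - v'| `^ (2 * H) + `|u - u'| `^ (2 * H))).
Proof.
move=> uT vT uT' vT'.
have L s t : s \in `[0, T] -> t \in `[0, T] -> Lall P (fun w => X s w * X t w).
  by move=> sT tT; apply: LallM; apply: fBm_Lall.
rewrite (_ : (fun w => _) = (fun w => (X v w * X v' w - X v w * X u' w) -
    (X u w * X v' w - X u w * X u' w))); last by apply/funext => w; ring.
rewrite !ExB//; try (by apply: LallB; apply: L); try (by apply: L).
rewrite !fBm_cov// /r (distrC v' v) (distrC u' v) (distrC v' u) (distrC u' u).
ring.
Qed.

(** The covariance is a mixed second difference of [x |-> |x|^(2H)], which is
convex since [2 * H >= 1]. *)
Lemma fBm_incr_cov_ge0 u v u' v' : u \in `[0, T] -> v \in `[0, T] ->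
  u' \in `[0, T] -> v' \in `[0, T] -> u <= v -> u' <= v' ->
  0 <= Ex P (fun w => (X v w - X u w) * (X v' w - X u' w)).
Proof.
move=> uT vT uT' vT' uv uv'; rewrite fBm_incr_cov// mulr_ge0// subr_ge0.
apply: four_point_convex; last by ring.
- by move: H_gt; lra.
- by rewrite lerD2r uv lerD2l lerN2 uv'.
Qed.

(** All Lq norms of a centered normal variable are proportional to its standard
deviation, here [|v - u|^H]. *)
Lemma fBm_incr_Lnorm_le q u v : 0 < q -> u \in `[0, T] -> v \in `[0, T] ->
  Lnorm_le P q (fun w => X v w - X u w)
    (abs_moment q `^ q^-1 / Num.sqrt (moment R 2) * `|v - u| `^ H).
Proof.
move=> q0 uT vT; have [s [s0 hb hm]] := fBm_incr uT vT.
suff -> : abs_moment q `^ q^-1 / Num.sqrt (moment R 2) * `|v - u| `^ H = abs_moment q `^ q^-1 * s.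
  exact: hb.
have m2 := moment2_gt0 R.
have sq0 : Num.sqrt (moment R 2) != 0 by rewrite gt_eqF// sqrtr_gt0.
have := hm 2%N; under eq_fun do rewrite expr2.
have H0 : 0 < H by move: H_gt; lra.
rewrite fBm_incr_cov// !subrr normr0 powR0; last by rewrite mulf_neq0// gt_eqF.
rewrite addr0 subr0 (distrC u v) => hv.
have e : (`|v - u| `^ H) ^+ 2 = (Num.sqrt (moment R 2) * s) ^+ 2.
  rewrite exprMn sqr_sqrtr ?(ltW m2)// -hv -powR_mulrn ?powR_ge0// -powRrM (mulrC H).
  by field.
have -> : `|v - u| `^ H = Num.sqrt (moment R 2) * s.
  by apply/eqP; rewrite -(eqrXn2 (_ : 0 < 2)%N) ?powR_ge0 ?mulr_ge0 ?sqrtr_ge0// e.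
by field.
Qed.

Lemma fBm_product_ge0 n (u v : 'I_n -> R) : (forall i, u i \in `[0, T]) ->
  (forall i, v i \in `[0, T]) -> (forall i, u i <= v i) ->
  0 <= Ex P (fun w => \prod_i (X (v i) w - X (u i) w)).
Proof.
move=> uT vT uv; apply: (gauss_product_ge0 (X := fun i w => X (v i) w - X (u i) w)).
- move=> S; have [s hs] := fBm_comb (fun i => (i \in S)%:R) uT vT.
  exists s; move: hs; congr centered_normal; apply/funext => w.
  rewrite [RHS]big_mkcond; apply: eq_bigr => i _.
  by case: ifP => _; rewrite ?mul1r ?mul0r.
- by move=> i; apply: LallB; apply: fBm_Lall.
- by move=> i j; apply: fBm_incr_cov_ge0.
Qed.

Lemma fBm_holder a : 1 / 2 < a -> a <= H -> holder P a (X \o clip 0 T).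
Proof.
move=> a_gt aH.
have cT t : clip 0 T t \in `[0, T] by rewrite in_itv/= clip_itv// ltW.
split=> [t|q q1]; first exact: fBm_Lall.
have q0 : 0 < q by lra.
exists (abs_moment q `^ q^-1 / Num.sqrt (moment R 2) * T `^ (H - a)) => s t.
apply: Lnorm_le_weak (fBm_incr_Lnorm_le q0 (cT s) (cT t)).
rewrite -[leRHS]mulrA; apply: ler_wpM2l.
  by rewrite mulr_ge0 ?powR_ge0// invr_ge0 sqrtr_ge0.
have lip : `|clip 0 T t - clip 0 T s| <= `|t - s| by apply: clip_lip; exact: ltW.
set x := `|clip 0 T t - clip 0 T s| in lip *.
have x0 : 0 <= x by apply: normr_ge0.
have xT : x <= T.
  have := cT t; have := cT s; rewrite !in_itv/= => /andP[? ?] /andP[? ?].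
  by rewrite /x ler_norml; apply/andP; split; lra.
have -> : H = (H - a) + a by ring.
rewrite powRD; last by apply/implyP => /eqP; move: H_gt; lra.
apply: ler_pM; rewrite ?powR_ge0//.
  rewrite addrK.
  by apply: ge0_ler_powR; rewrite ?nnegrE ?subr_ge0// ltW.
by apply: ge0_ler_powR; rewrite ?nnegrE//; lra.
Qed.

End FBm.

Section Time.
Context d (Omega : measurableType d) (R : realType) (P : probability Omega R).
Variables (T : R) (X : R -> Omega -> R).
Hypothesis T0 : 0 < T.
Hypothesis tX : is_time T X.

Lemma time_holder a : 1 / 2 < a -> a <= 1 -> holder P a (X \o clip 0 T).
Proof.
move=> a_gt a1.
have cT t : clip 0 T t \in `[0, T] by rewrite in_itv/= clip_itv// ltW.
have XE t : X (clip 0 T t) = fun=> clip 0 T t by apply/funext => w; rewrite tX.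
split=> [t|q q1]; first by rewrite /= XE; exact: Lall_cst.
have q0 : 0 < q by lra.
exists (T `^ (1 - a)) => s t; rewrite /= !XE.
apply: Lnorm_le_weak (Lnorm_le_cst P _ q0).
have lip : `|clip 0 T t - clip 0 T s| <= `|t - s| by apply: clip_lip; exact: ltW.
set x := `|clip 0 T t - clip 0 T s| in lip *.
have x0 : 0 <= x by apply: normr_ge0.
have xT : x <= T.
  have := cT t; have := cT s; rewrite !in_itv/= => /andP[? ?] /andP[? ?].
  by rewrite /x ler_norml; apply/andP; split; lra.
rewrite -{1}(powRr1 x0) -{1}(subrK a 1).
rewrite powRD; last by apply/implyP => /eqP; lra.
by apply: ler_pM; rewrite ?powR_ge0//; apply: ge0_ler_powR; rewrite ?nnegrE ?subr_ge0 ?(ltW T0)//; lra.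
Qed.

End Time.

(** * Expectation of products of independent variables *)

Section Independence.
Import HBSimple HBNNSimple.
Context d (Omega : measurableType d) (R : realType) (P : probability Omega R).
Implicit Types X Y Z : Omega -> R.

Lemma Lall_dom X Y : measurable_fun setT X -> (forall w, `|X w| <= `|Y w|) ->
  Lall P Y -> Lall P X.
Proof.
move=> mX XY LY q q1; have q0 : 0 < q by lra.
have [C hC] := LY q q1; exists C; have C0 := Lnorm_le_ge0 hC.
have hY := (Lnorm_leP P q0 C0 hC.1).1 hC; apply/(Lnorm_leP P q0 C0 mX).
apply: le_trans hY; apply: ge0_le_integral => //.
- by apply/measurable_EFinP; exact: measurable_abspow.
- by apply/measurable_EFinP; apply: measurable_abspow; exact: hC.1.
move=> w _; rewrite lee_fin; apply: ge0_ler_powR; rewrite ?nnegrE//; exact: ltW.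
Qed.

Lemma Lall_indic (E : set Omega) : measurable E -> Lall P (\1_E : Omega -> R).
Proof.
move=> mE; apply: Lall_dom (Lall_cst P 1); first exact: measurable_indic.
by move=> w; rewrite indicE; case: (_ \in _); rewrite ?normr1 ?normr0.
Qed.

Lemma Ex_indic (E : set Omega) : measurable E -> Ex P \1_E = fine (P E).
Proof. by move=> mE; rewrite /Ex expectation_indic. Qed.

Variable G : set (set Omega).
Hypothesis mG : forall E, <<s G >> E -> measurable E.
Variable Z : Omega -> R.
Hypothesis LZ : Lall P Z.
Hypothesis indepZ : forall E, <<s G >> E ->
  Ex P (fun w => Z w * \1_E w) = Ex P Z * fine (P E).

Local Notation OmG := (g_sigma_algebraType G).

Lemma meas_sub (Y : OmG -> R) : measurable_fun setT Y -> measurable_fun setT (Y : Omega -> R).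
Proof. by move=> mY _ U mU; apply: mG; exact: mY. Qed.

Lemma indep_mul_simple (Y : OmG -> R) (f : {nnsfun OmG >-> R}) :
  (forall w, Y w = f w) -> Lall P (Y : Omega -> R) ->
  Ex P (fun w => Z w * Y w) = Ex P Z * Ex P (Y : Omega -> R).
Proof.
move=> Yf LY.
pose s : seq R := finmap.enum_fset (fset_set (range f)).
have sE y : <<s G >> (f @^-1` [set y]).
  rewrite -[X in <<s G >> X]setTI.
  exact: (@measurable_funP _ _ OmG R setT f measurableT [set y] (measurable_set1 y)).
have mE y : measurable (f @^-1` [set y] : set Omega) by apply: mG; apply: sE.
have YE w : Y w = \sum_(y <- s) y * \1_(f @^-1` [set y]) w.
  by rewrite Yf fimfunE fsbig_finite.
have L1 y : Lall P (fun w => y * \1_(f @^-1` [set y] : set Omega) w).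
  by apply: LallZ; exact: Lall_indic.
have -> : (Y : Omega -> R) = fun w => \sum_(y <- s) y * \1_(f @^-1` [set y]) w.
  by apply/funext => w; exact: YE.
rewrite [in RHS]Ex_sum// mulr_sumr.
rewrite (_ : (fun w => _) =
    (fun w => \sum_(y <- s) y * (Z w * \1_(f @^-1` [set y] : set Omega) w))); last first.
  apply/funext => w; rewrite mulr_sumr.
  by apply: eq_bigr => y _; rewrite mulrCA.
have L2 y : Lall P (fun w => Z w * \1_(f @^-1` [set y] : set Omega) w).
  by apply: LallM => //; exact: Lall_indic.
rewrite Ex_sum; last by move=> y; apply: LallZ.
apply: eq_bigr => y _; rewrite ExZ// indepZ// ExZ ?Ex_indic//; last exact: Lall_indic.
by rewrite mulrCA.
Qed.

Lemma Ex_dominated (f : nat -> Omega -> R) (g h : Omega -> R) :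
  (forall n, Lall P (f n)) -> Lall P g -> Lall P h ->
  (forall w, f ^~ w @ \oo --> g w) -> (forall n w, `|f n w| <= h w) ->
  Ex P (f n) @[n --> \oo] --> Ex P g.
Proof.
move=> Lf Lg Lh fg fh.
have mE X : Lall P X -> measurable_fun setT (EFin \o X).
  by move=> L; apply/measurable_EFinP; exact: (Lall_meas L).
have ae_fg : {ae P, forall w, setT w -> (fun n => (EFin \o f n) w) @ \oo --> (EFin \o g) w}.
  by apply: aeW => w _ /=; apply: cvg_EFin => //; [exact: nearW | exact: fg].
have ae_fh : {ae P, forall w n, setT w -> (`|(EFin \o f n) w| <= (EFin \o h) w)%E}.
  by apply: aeW => w n _; rewrite /= lee_fin.
have [_ _] := dominated_convergence measurableT (fun n => mE _ (Lf n)) (mE _ Lg)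
  ae_fg (Lall_int Lh) ae_fh.
have gE : (\int[P]_x (EFin \o g) x)%E = (Ex P g)%:E.
  by rewrite -Lall_fin// unlock.
rewrite gE => /fine_cvgP[_].
rewrite /Ex unlock; apply: cvg_trans; apply: near_eq_cvg.
by apply: nearW => n.
Qed.

Lemma indep_mul_ge0 (Y : OmG -> R) : measurable_fun setT Y -> (forall w, 0 <= Y w) ->
  Lall P (Y : Omega -> R) -> Ex P (fun w => Z w * Y w) = Ex P Z * Ex P (Y : Omega -> R).
Proof.
move=> mY Y0 LY.
have mEY : measurable_fun [set: OmG] (EFin \o Y) by apply/measurable_EFinP.
pose f n : OmG -> R := nnsfun_approx measurableT mEY n.
have fY n w : f n w <= Y w.
  rewrite -lee_fin /f nnsfun_approxE.
  by apply: (@le_approx _ _ _ setT (EFin \o Y)) => // x _; rewrite lee_fin.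
have f0 n w : 0 <= f n w by [].
have fcvg w : (f n w) @[n --> \oo] --> Y w.
  have h := @cvg_nnsfun_approx _ _ _ setT measurableT _ mEY (fun x _ => Y0 x) w I.
  by have /fine_cvgP[_] := h.
have mf n : measurable_fun setT (f n : Omega -> R) by apply: (@meas_sub (f n)).
have Lf n : Lall P (f n : Omega -> R).
  by apply: Lall_dom LY => // w; rewrite !ger0_norm.
have c1 := Ex_dominated Lf LY LY fcvg (fun n w => _).
have {}c1 : Ex P (f n : Omega -> R) @[n --> \oo] --> Ex P (Y : Omega -> R).
  by apply: c1 => n w; rewrite ger0_norm.
have LZY : Lall P (fun w => `|Z w| * Y w).
  apply: LallM => //; apply: Lall_dom LZ; last by move=> w; rewrite normr_id.
  by apply: measurableT_comp => //; exact: (Lall_meas LZ).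
have c2 : Ex P (fun w => Z w * f n w) @[n --> \oo] --> Ex P (fun w => Z w * Y w).
  apply: (Ex_dominated (h := fun w => `|Z w| * Y w)) => //.
  - by move=> n; apply: LallM.
  - exact: LallM.
  - by move=> w; apply: (@cvgMl_tmp _ _ _ _ (f ^~ w)); exact: fcvg.
  - by move=> n w; rewrite normrM ler_wpM2l// ger0_norm.
have c3 : Ex P (fun w => Z w * f n w) @[n --> \oo] --> Ex P Z * Ex P (Y : Omega -> R).
  under eq_fun => n do rewrite (indep_mul_simple (f := nnsfun_approx measurableT mEY n))//.
  apply: (@cvgMl_tmp _ _ _ _ (fun n => Ex P (f n : Omega -> R))); exact: c1.
exact: (cvg_unique _ c2 c3).
Qed.

Lemma indep_mul (Y : OmG -> R) : measurable_fun setT Y -> Lall P (Y : Omega -> R) ->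
  Ex P (fun w => Z w * Y w) = Ex P Z * Ex P (Y : Omega -> R).
Proof.
move=> mY LY.
pose p w := Num.max (Y w) 0; pose n w := Num.max (- Y w) 0.
have mp : measurable_fun [set: OmG] p by apply: measurable_maxr.
have mn : measurable_fun [set: OmG] n by apply: measurable_maxr => //; exact: measurableT_comp.
have p0 w : 0 <= p w by rewrite le_max lexx orbT.
have n0 w : 0 <= n w by rewrite le_max lexx orbT.
have pY w : `|p w| <= `|Y w|.
  by rewrite ger0_norm// /p ge_max normr_ge0 ler_norm.
have nY w : `|n w| <= `|Y w|.
  by rewrite ger0_norm// /n ge_max normr_ge0 -normrN ler_norm.
have Lp : Lall P (p : Omega -> R) by apply: Lall_dom LY => //; exact: meas_sub mp.
have Ln : Lall P (n : Omega -> R) by apply: Lall_dom LY => //; exact: meas_sub mn.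
have YE w : Y w = p w - n w.
  rewrite /p /n; have [y0|y0] := leP (Y w) 0.
    by rewrite max_l ?oppr_ge0// sub0r opprK.
  by rewrite max_r ?subr0// oppr_le0 ltW.
have -> : Ex P (fun w => Z w * Y w) = Ex P (fun w => Z w * p w - Z w * n w).
  by congr Ex; apply/funext => w; rewrite YE mulrBr.
have -> : Ex P (Y : Omega -> R) = Ex P (fun w => p w - n w).
  by congr Ex; apply/funext => w; rewrite YE.
rewrite !ExB//; [|exact: LallM|exact: LallM].
by rewrite (indep_mul_ge0 mp)// (indep_mul_ge0 mn)// mulrBr.
Qed.

End Independence.

Section MutualIndependence.
Context d (Omega : measurableType d) (R : realType) (P : probability Omega R).
Variables (T : R) (I : finType) (D : {set I}) (X : I -> R -> Omega -> R).
Hypothesis mX : forall i t, t \in `[0, T] -> measurable_fun setT (X i t).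
Hypothesis indepX : mutually_independent P T D X.

Definition generators i : set (set Omega) := [set E | exists (t : R) (U : set R),
         [/\ t \in `[0, T], measurable U & E = X i t @^-1` U] ].

Lemma generators_meas i E : <<s generators i >> E -> measurable E.
Proof.
apply: smallest_sub; first exact: sigma_algebra_measurable.
by move=> _ [t [U [tT mU ->]]]; rewrite -[X in measurable X]setTI; apply: mX.
Qed.

(** Induction on the number of factors that are arbitrary; the product rule for
events is the case where all of them are indicators.  For [j] in [S], the
induction hypothesis with [W j] replaced by an indicator says that the product
[Z] of the other factors is uncorrelated with the events of [X j], and
[indep_mul] passes from these events to [W j]. *)
Lemma indep_prod_aux k : forall (S : {set I}) (W : I -> Omega -> R), #|S| = k ->
  (forall i, i \in D -> i \in S ->
     measurable_fun [set: g_sigma_algebraType (generators i)] (W i) /\ Lall P (W i)) ->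
  (forall i, i \in D -> i \notin S -> exists E, <<s generators i >> E /\ W i = \1_E) ->
  Ex P (fun w => \prod_(i in D) W i w) = \prod_(i in D) Ex P (W i).
Proof.
elim: k => [|k IH] S W cS hW hE.
  have S0 i : i \notin S by move: cS => /eqP; rewrite cards_eq0 => /eqP ->; rewrite inE.
  have [E hEi] : exists E : I -> set Omega, forall i, i \in D -> <<s generators i >> (E i) /\ W i = \1_(E i).
    have h i : exists E, i \in D -> <<s generators i >> E /\ W i = \1_E.
      case: (boolP (i \in D)) => [iD|_]; last by exists set0.
      by have [E ?] := hE i iD (S0 i); exists E.
    by have [E ?] := choice h; exists E.
  have -> : (fun w => \prod_(i in D) W i w) = \1_(\bigcap_(i in [set` D]) E i).
    apply/funext => w; rewrite indicE.
    case: (boolP (w \in _)) => [/set_mem h|/negP h].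
      rewrite big1// => i iD; have [_ ->] := hEi i iD.
      by rewrite indicE mem_set//; apply: h.
    have [i iD iE] : exists2 i, i \in D & ~ E i w.
      apply: contrapT => hn; apply: h; apply/mem_set => i /= iD.
      by apply: contrapT => niE; apply: hn; exists i.
    rewrite (bigD1 i)//=; have [_ ->] := hEi i iD.
    by rewrite indicE memNset// mul0r.
  have mE i : i \in D -> measurable (E i) by move=> iD; apply: (@generators_meas i); have [] := hEi i iD.
  rewrite Ex_indic; last by apply: fin_bigcap_measurable => //; exact: finite_finset.
  rewrite indepX; last by move=> i iD; have [] := hEi i iD.
  by apply: eq_bigr => i iD; have [_ ->] := hEi i iD; rewrite Ex_indic//; exact: mE.
have [j jS] : exists j, j \in S by apply/card_gt0P; rewrite cS.
have cS' : #|S :\ j| = k by move: cS; rewrite (cardsD1 j) jS add1n => -[].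
have [jD|jD] := boolP (j \in D); last first.
  apply: (IH (S :\ j)) => // i iD.
    by rewrite !inE => /andP[_]; apply: hW.
  rewrite !inE negb_and negbK => /orP[/eqP ij|]; last exact: hE.
  by move: jD; rewrite -ij iD.
have LW i : i \in D -> Lall P (W i).
  move=> iD; have [iS|iS] := boolP (i \in S); first by have [] := hW i iD iS.
  have [E [sE ->]] := hE i iD iS; apply: Lall_indic; exact: generators_meas sE.
pose Z w := \prod_(i in D | i != j) W i w.
have LZ : Lall P Z.
  rewrite (_ : Z = fun w => \prod_(i <- [seq i <- enum I | (i \in D) && (i != j)]) 
     (if i \in D then W i else fun=> 1) w).
    by apply: Lall_prod => i; case: ifPn => [/LW//|_]; exact: Lall_cst.
  apply/funext => w; rewrite /Z big_filter big_enum_cond/=.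
  by apply: eq_bigr => i /andP[-> _].
have key E : <<s generators j >> E ->
    Ex P (fun w => Z w * \1_E w) = (\prod_(i in D | i != j) Ex P (W i)) * fine (P E).
  move=> sE; pose W' i := if i == j then \1_E else W i.
  have := IH (S :\ j) W' cS'.
  have -> : (fun w => \prod_(i in D) W' i w) = (fun w => Z w * \1_E w).
    apply/funext => w; rewrite (bigD1 j)//= mulrC /W' eqxx; congr (_ * _).
    by apply: eq_bigr => i /andP[_ /negbTE ->].
  move=> ->.
  - rewrite (bigD1 j)//= mulrC /W' eqxx Ex_indic; last exact: generators_meas sE.
    by congr (_ * _); apply: eq_bigr => i /andP[_ /negbTE ->].
  - move=> i iD; rewrite !inE => /andP[ij iS]; rewrite /W' (negbTE ij).
    exact: hW.
  - move=> i iD; rewrite !inE negb_and negbK /W'.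
    case: eqP => [->|ij] /= iS; first by exists E.
    exact: hE.
have EZ : Ex P Z = \prod_(i in D | i != j) Ex P (W i).
  have sT : <<s generators j >> [set: Omega].
    by apply: (@measurableT _ (g_sigma_algebraType (generators j))).
  have := key _ sT; rewrite probability_setT mulr1 => <-.
  by congr Ex; apply/funext => w; rewrite indicT mulr1.
have [mWj LWj] := hW j jD jS.
rewrite (bigD1 j)//= mulrC -EZ.
rewrite -(indep_mul (@generators_meas j) LZ _ mWj LWj); last by move=> E sE; rewrite key// EZ.
by congr Ex; apply/funext => w; rewrite (bigD1 j)//= mulrC.
Qed.

Lemma indep_prod (Y : I -> Omega -> R) :
  (forall i, i \in D -> measurable_fun [set: g_sigma_algebraType (generators i)] (Y i)) ->
  (forall i, i \in D -> Lall P (Y i)) ->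
  Ex P (fun w => \prod_(i in D) Y i w) = \prod_(i in D) Ex P (Y i).
Proof.
move=> mY LY; apply: (indep_prod_aux (S := D) (erefl _)).
  by move=> i iD _; split; [exact: mY|exact: LY].
by move=> i iD; rewrite iD.
Qed.

Lemma generators_process i t : t \in `[0, T] -> measurable_fun [set: g_sigma_algebraType (generators i)] (X i t).
Proof.
move=> tT _ U mU; rewrite setTI; apply: sub_sigma_algebra.
by exists t, U.
Qed.

End MutualIndependence.

(** * Dual cones and the comparison of integrals *)

Section Cones.
Context d (Omega : measurableType d) (R : realType) (P : probability Omega R).
Implicit Types (K : set (Omega -> R)) (X Y Z : Omega -> R).

Definition dual_cone K : set (Omega -> R) :=
  [set X | Lall P X /\ forall Z, K Z -> 0 <= Ex P (fun w => X w * Z w)].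

Lemma dual_cone_Lall K X : dual_cone K X -> Lall P X. Proof. by case. Qed.

Lemma dual_cone_mul K X Z : dual_cone K X -> Lall P Z ->
  (forall Y, K Y -> K (fun w => Z w * Y w)) -> dual_cone K (fun w => X w * Z w).
Proof.
move=> [LX hX] LZ hK; split=> [|Y KY]; first exact: LallM.
rewrite (_ : (fun w => _) = (fun w => X w * (Z w * Y w))); first exact/hX/hK.
by apply/funext => w; rewrite mulrA.
Qed.

(** [dual_cone K] satisfies the conditions of [iter_Lall_cone]: an increment is
moved from one factor of the pairing to the other, where [K] absorbs it. *)
Lemma dual_cone_integral K T r (b : 'I_r -> R -> Omega -> R) phi J : 0 < T ->
  (forall Z, K Z -> Lall P Z) -> (forall i u, Lall P (b i u)) ->
  (forall i u v Z, u <= v -> K Z -> K (fun w => (b i v w - b i u w) * Z w)) ->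
  (forall s, cube 0 T s -> dual_cone K (phi s)) -> iter_Lall P T b phi J -> dual_cone K J.
Proof.
move=> T0 LK Lb Kb hphi; apply: (iter_Lall_cone T0 (Q := dual_cone K)) => //.
- split=> [|Z KZ]; first exact: Lall_cst.
  rewrite (_ : (fun w => _) = (fun=> 0)) ?Ex_cst//.
  by apply/funext => w; rewrite mul0r.
- move=> X Y [LX hX] [LY hY]; split=> [|Z KZ]; first exact: LallD.
  rewrite (_ : (fun w => _) = (fun w => X w * Z w + Y w * Z w)).
    by rewrite ExD; [apply: addr_ge0; [apply: hX|apply: hY]|apply: LallM => //; exact: LK..].
  by apply/funext => w; rewrite mulrDl.
- move=> i u v X _ _ uv hX; apply: dual_cone_mul => // [|Y]; first exact: LallB.
  exact: Kb.
- move=> S X hS LX SX; split=> // Z KZ.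
  apply: (@cvg_Lall_ge0 _ _ _ _ (fun n => S n.+1)) => //.
  + by move=> n; have [] := hS n.+1 isT.
  + exact: LK.
  + move=> q e q1 e0; have [N hN] := SX q e q1 e0.
    by exists N => n Nn; apply: hN; apply: leq_trans Nn _.
  + by move=> n; have [_] := hS n.+1 isT; apply.
Qed.

End Cones.

Section Increments.
Context d (Omega : measurableType d) (R : realType) (P : probability Omega R).
Variables (T : R) (r : nat) (B : 'I_r -> R -> Omega -> R).
Hypothesis T0 : 0 < T.
Hypothesis hB : forall j, (exists H : R, 1 / 2 < H /\ is_fBm P T H (B j)) \/
                    is_time T (B j).
Hypothesis hindep : equal_or_independent P T B.

Let clipT u : clip 0 T u \in `[0, T].
Proof. by rewrite in_itv/= clip_itv// ltW. Qed.

Lemma process_Lall j u : u \in `[0, T] -> Lall P (B j u).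
Proof.
move=> uT; have [[H [H1 fX]]|tX] := hB j; first exact: fBm_Lall fX _ uT.
by rewrite (_ : B j u = fun=> u); [exact: Lall_cst|apply/funext => w; exact: tX].
Qed.

(** Freezing the processes outside [[0, T]] leaves the integrals unchanged and
removes the restriction to [[0, T]] from the estimates. *)
Definition stopped j := B j \o clip 0 T.

Lemma stopped_Lall j u : Lall P (stopped j u). Proof. exact: process_Lall. Qed.

Lemma one_process_product_ge0 j (s : seq (R * R)) : all (fun x => x.1 <= x.2) s ->
  0 <= Ex P (fun w => \prod_(x <- s) (stopped j x.2 w - stopped j x.1 w)).
Proof.
move=> hs; have [[H [H1 fX]]|tX] := hB j.
  pose u k := clip 0 T (tnth (in_tuple s) k).1; pose v k := clip 0 T (tnth (in_tuple s) k).2.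
  rewrite (_ : (fun w => _) = (fun w => \prod_k (B j (v k) w - B j (u k) w))); last first.
    by apply/funext => w; rewrite big_tnth.
  apply: (fBm_product_ge0 H1 fX (u := u) (v := v)) => k; rewrite /u /v ?clipT//.
  by apply: clip_le; apply: (allP hs); exact: mem_tnth.
rewrite (_ : (fun w => _) = (fun=> \prod_(x <- s) (clip 0 T x.2 - clip 0 T x.1))); last first.
  by apply/funext => w; apply: eq_bigr => x _; rewrite /stopped /= !tX.
rewrite Ex_cst big_seq; apply: prodr_ge0 => x /(allP hs) h.
by rewrite subr_ge0; exact: clip_le.
Qed.

(** A common representative for all indices of the same process. *)
Definition rep j : 'I_r := odflt j [pick k | `[< same_process T (B j) (B k) >] ].

Lemma rep_same j : same_process T (B j) (B (rep j)).
Proof. by rewrite /rep; case: pickP => [k /asboolP|_] //= u uT. Qed.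

Lemma rep_eq j k : same_process T (B j) (B k) -> rep j = rep k.
Proof.
move=> jk; rewrite /rep.
have e : (fun l => `[< same_process T (B j) (B l) >]) =1 (fun l => `[< same_process T (B k) (B l) >]).
  by move=> l; apply/asboolP/asboolP => h u uT; rewrite -h// jk.
rewrite (eq_pick e); case: pickP => [//|/(_ k)/asboolP []] //.
Qed.

Lemma rep_id j : rep (rep j) = rep j.
Proof. by apply: esym; apply: rep_eq; exact: rep_same. Qed.

Definition increment (x : 'I_r * (R * R)) w := stopped x.1 x.2.2 w - stopped x.1 x.2.1 w.

Lemma increment_Lall x : Lall P (increment x).
Proof. by apply: LallB; exact: stopped_Lall. Qed.

(** Independence is assumed for distinct processes only, so the factors are first
grouped by process.  The expectation of the product is then the product of the
expectations over the groups. *)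
Lemma increment_product_ge0 (s : seq ('I_r * (R * R))) : all (fun x => x.2.1 <= x.2.2) s ->
  0 <= Ex P (fun w => \prod_(x <- s) increment x w).
Proof.
move=> hs; pose D := [set rep j | j in 'I_r]%SET.
have indepD : mutually_independent P T D B.
  apply: hindep => _ _ /imsetP[j _ ->] /imsetP[k _ ->] jk sjk.
  by move: jk; rewrite -(rep_id j) -(rep_id k) (rep_eq sjk) eqxx.
pose s_ j := [seq x.2 | x <- s & rep x.1 == j].
pose Y j w := \prod_(x <- s_ j) (stopped j x.2 w - stopped j x.1 w).
have -> : (fun w => \prod_(x <- s) increment x w) = (fun w => \prod_(j in D) Y j w).
  apply/funext => w.
  rewrite (partition_big (fun x : 'I_r * (R * R) => rep x.1) (mem D)) /=; last first.
    by move=> x _; apply: imset_f.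
  apply: eq_bigr => j _; rewrite /Y /s_ big_map big_filter.
  by apply: eq_bigr => x /eqP <-; rewrite /increment /stopped /= !(rep_same x.1).
rewrite (indep_prod _ indepD).
- apply: prodr_ge0 => j _; apply: one_process_product_ge0.
  by rewrite all_map; apply/allP => x; rewrite mem_filter => /andP[_] /(allP hs).
- by move=> j t tT; apply: Lall_meas (process_Lall j tT).
- move=> j _; apply: measurable_prod => x _.
  by apply: measurable_funB; apply: generators_process.
- move=> j _; apply: Lall_prod => x; apply: LallB; exact: stopped_Lall.
Qed.

Lemma common_exponent : exists a, 1 / 2 < a /\ forall j, holder P a (stopped j).
Proof.
have h j : exists h, [/\ 1 / 2 < h, h <= 1 &
    forall a, 1 / 2 < a -> a <= h -> holder P a (stopped j)].
  have [[H [H1 fX]]|tX] := hB j; last first.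
    by exists 1; split; [lra|exact: lexx|move=> a a1 a2; exact: time_holder].
  exists H; split=> // [|a a1 a2]; last exact: (fBm_holder T0 H1 fX).
  by have [/andP[_ /ltW]] := fX.
have {h} [h hh] := choice h.
exists (\big[Num.min/1]_j h j); split.
  apply: lt_bigmin => [|j _]; first by lra.
  by have [] := hh j.
move=> j; have [_ _] := hh j; apply.
  apply: lt_bigmin => [|k _]; first by lra.
  by have [] := hh k.
exact: bigmin_le_cond.
Qed.

Definition products : set (Omega -> R) :=
  [set Z | exists2 s : seq ('I_r * (R * R)), all (fun x => x.2.1 <= x.2.2) s &
           Z = fun w => \prod_(x <- s) increment x w].

Lemma products_Lall Z : products Z -> Lall P Z.
Proof. by move=> [s _ ->]; apply: Lall_prod => x; exact: increment_Lall. Qed.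

Lemma products_incr i u v Z : u <= v -> products Z ->
  products (fun w => (stopped i v w - stopped i u w) * Z w).
Proof.
move=> uv [s hs ->]; exists ((i, (u, v)) :: s); first by rewrite /= uv.
by apply/funext => w; rewrite big_cons.
Qed.

Lemma dual_products_cst c : 0 <= c -> dual_cone P products (fun=> c).
Proof.
move=> c0; split=> [|Z pZ]; first exact: Lall_cst.
rewrite ExZ; last exact: products_Lall.
by rewrite mulr_ge0//; case: pZ => s hs ->; exact: increment_product_ge0.
Qed.

Lemma bidual_products_cst c : 0 <= c -> dual_cone P (dual_cone P products) (fun=> c).
Proof.
move=> c0; split=> [|Z [LZ pZ]]; first exact: Lall_cst.
rewrite ExZ// mulr_ge0//.
rewrite (_ : Z = fun w => Z w * 1); last by apply/funext => w; rewrite mulr1.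
by apply: pZ; exists [::] => //; apply/funext => w; rewrite big_nil.
Qed.

(** [J'^2 - J^2 = (J' - J) * (J' + J)], and the two factors lie in cones that are
dual to each other. *)
Lemma integral_mono (phi phi' : r.-tuple R -> R) J J' :
  (forall s, cube 0 T s -> 0 <= phi s <= phi' s) ->
  iter_Lall P T stopped (fun s _ => phi s) J -> iter_Lall P T stopped (fun s _ => phi' s) J' ->
  Ex P (fun w => J w * J w) <= Ex P (fun w => J' w * J' w).
Proof.
move=> hphi hJ hJ'.
have hD : dual_cone P (dual_cone P products) (fun w => J' w + -1 * J w).
  apply: (dual_cone_integral T0 _ _ _ _ (iter_Lall_lin (-1) hJ' hJ)).
  - by move=> Z; exact: dual_cone_Lall.
  - exact: stopped_Lall.
  - move=> i u v Z uv hZ.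
    rewrite (_ : (fun w => _) = (fun w => Z w * (stopped i v w - stopped i u w))).
      apply: dual_cone_mul => // [|Y]; last exact: products_incr.
      by apply: LallB; exact: stopped_Lall.
    by apply/funext => w; rewrite mulrC.
  - move=> s cs; apply: (bidual_products_cst (c := phi' s + -1 * phi s)).
    by rewrite mulN1r subr_ge0; have /andP[] := hphi s cs.
have hS : dual_cone P products (fun w => J' w + 1 * J w).
  apply: (dual_cone_integral T0 _ _ _ _ (iter_Lall_lin 1 hJ' hJ)).
  - exact: products_Lall.
  - exact: stopped_Lall.
  - by move=> i u v Z uv; exact: products_incr.
  - move=> s cs; apply: (dual_products_cst (c := phi' s + 1 * phi s)).
    by rewrite mul1r; have /andP[h1 h2] := hphi s cs; rewrite addr_ge0// (le_trans h1).
have LJ : Lall P J.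
  have LS := LallB (dual_cone_Lall hS) (dual_cone_Lall hD).
  rewrite (_ : J = fun w => 2^-1 * (J' w + 1 * J w - (J' w + -1 * J w))); first exact: LallZ.
  by apply/funext => w; field.
have LJ' : Lall P J'.
  have LS := LallD (dual_cone_Lall hS) (dual_cone_Lall hD).
  rewrite (_ : J' = fun w => 2^-1 * (J' w + 1 * J w + (J' w + -1 * J w))); first exact: LallZ.
  by apply/funext => w; field.
have [_ /(_ _ hS)] := hD.
rewrite (_ : (fun w => _) = (fun w => J' w * J' w - J w * J w)); last by apply/funext => w; ring.
by rewrite ExB ?subr_ge0//; exact: LallM.
Qed.

End Increments.

Lemma iterated_integral_Lfun d (Omega : measurableType d) (R : realType)
    (P : probability Omega R) (p T : R) r (B : 'I_r.+1 -> R -> Omega -> R) phi J :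
  is_iterated_integral P p T B phi J -> J \in Lfun P p%:E.
Proof.
elim: r B phi => [|r IH] B phi; last by move=> [psi [_ /(IH (fun i => B (lift ord0 i)))]].
move=> [psi [hpsi ->]].
by have [] := hpsi [tuple] ltac:(by move=> -[]).
Qed.

Theorem proposition5p5 (R : realType) (d : measure_display)
    (Omega : measurableType d) (P : probability Omega R)
    (p T : R) (r n : nat) (B : 'I_r -> R -> Omega -> R) (t : nat -> R)
    (hp : 1 <= p) (hT : 0 < T) (hr : (0 < r)%N)
    (hB : forall j, (exists H : R, 1 / 2 < H /\ is_fBm P T H (B j)) \/
                    is_time T (B j))
    (hindep : equal_or_independent P T B)
    (ht0 : t 0%N = 0) (htn : t n = T)
    (htS : forall k, (k < n)%N -> t k < t k.+1) :
  let A := \bigcup_(k < n) @simplex R r T (t k) (t k.+1) in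
  let A' := \bigcup_(k < n) @cube R r (t k) (t k.+1) in
  [/\ J_well_defined P p T B A,
      J_well_defined P p T B A' &
      forall J J' : Omega -> R, is_J P p T B A J -> is_J P p T B A' J' ->
        ('E_P[(fun w => `|J w| ^+ 2)%R] <= 'E_P[(fun w => `|J' w| ^+ 2)%R])%E].
Proof.
case: r hr B hB hindep => [//|r] _ B hB hindep A A'.
have [a [a_gt HldB]] := common_exponent hT hB.
have [J [LJ iJ]] := simplices_integral a_gt hT HldB ht0 htn htS.
have [J' [LJ' iJ']] := cubes_integral a_gt hT HldB ht0 htn htS.
(* integrals against the stopped processes in every Lq are integrals against [B]
   in Lp, as all grid points lie in [[0, T]] *)
have JB phi K : iter_Lall P T (stopped T B) phi K -> is_iterated_integral P p T B phi K.
  move=> h; apply: iter_Lall_iterated => // [i u uT|]; first exact: process_Lall hB _ _ uT.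
  apply: iter_Lall_ext h => // i u; rewrite in_itv /= => uT.
  by rewrite /stopped /= clip_id.
have uniq (S : set (r.+1.-tuple R)) K1 K2 : is_J P p T B S K1 -> is_J P p T B S K2 ->
    {ae P, forall w, K1 w = K2 w}.
  by apply: iter_unique => // s _; apply: aeW.
have hA : is_J P p T B A J := JB _ _ iJ.
have hA' : is_J P p T B A' J' := JB _ _ iJ'.
split.
- by split; [exists J|exact: uniq].
- by split; [exists J'|exact: uniq].
move=> K K' hK hK'.
have sq X : Lall P X -> 'E_P[(fun w => `|X w| ^+ 2)%R]%E = (Ex P (fun w => X w * X w))%:E.
  move=> LX; rewrite -Lall_fin; last exact: LallM.
  by congr expectation; apply/funext => w; rewrite real_normK ?num_real// expr2.
have mI (S : set (r.+1.-tuple R)) X : is_J P p T B S X -> measurable_fun setT X.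
  by move/iterated_integral_Lfun; rewrite inE => /andP[]; rewrite inE.
have sqE (S : set (r.+1.-tuple R)) X Y : is_J P p T B S X -> is_J P p T B S Y -> 
    'E_P[(fun w => `|X w| ^+ 2)%R]%E = 'E_P[(fun w => `|Y w| ^+ 2)%R]%E.
  move=> hX hY; rewrite unlock; apply: ae_eq_integral => //.
  - by apply/measurable_EFinP; apply: measurable_funX; apply: measurableT_comp => //; exact: mI hX.
  - by apply/measurable_EFinP; apply: measurable_funX; apply: measurableT_comp => //; exact: mI hY.
  - by apply: filterS (uniq _ _ _ hX hY) => w /= -> _.
rewrite (sqE _ _ _ hK hA) (sqE _ _ _ hK' hA') !sq// lee_fin.
apply: (integral_mono hT hB hindep _ iJ iJ') => s cs; rewrite !indicE ler0n ler_nat/=.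
case: (boolP (s \in \bigcup_(k < n) simplex T (t k) (t k.+1))) => // /set_mem[k kn].
have /ltW tk := htS k kn.
move/(simplexE T s tk) => [_ _ h]; rewrite mem_set//; by exists k.
Qed.
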